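(* Let $N\ge 2$, $\gamma>0$, $\mu>0$, $p\ge 0$ and $0\le q<2$ with $p+q-1>0$. Let $\omega$ be a solution of $$-\Delta'\omega+\mu\omega-|\omega|^{p-1}\omega\left(\gamma^2\omega^2+|\nabla'\omega|^2\right)^{\frac q2}=0\quad\text{on }S^{N-1}$$ satisfying $$c_2^2\le\gamma^2\omega^2+|\nabla'\omega|^2\le c_1^2\quad\text{on }S^{N-1}$$ for some $c_1>c_2>0$, and set $$c_*=\begin{cases}c_1^{p+q-1}&\text{if }p\ge 1,\\ c_2^{p-1}c_1^{q}&\text{if }0\le p<1.\end{cases}$$ If $$c_*\le\frac{2(N-1+\mu)\gamma^p}{q\sqrt{N-1}+2(p+q)\gamma},$$ then $\omega$ is constant.
   Context: $S^{N-1}$ is the unit sphere of $\mathbb{R}^N$ with its standard round metric; $\nabla'$ and $\Delta'$ are respectively the covariant gradient and the Laplace–Beltrami operator on $S^{N-1}$. Solutions are classical, i.e. of class $C^2$. *)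

(* Defs.v *)
From HB Require Import structures.
From mathcomp Require Import all_boot all_order all_algebra.
From mathcomp Require Import all_classical all_reals all_analysis.

Set Implicit Arguments.
Unset Strict Implicit.
Unset Printing Implicit Defensive.

Import Order.TTheory GRing.Theory Num.Theory.
Import numFieldNormedType.Exports.

Local Open Scope classical_set_scope.
Local Open Scope ring_scope.

(* MathComp-Analysis world.  The library norm on 'rV[R]_N is the sup norm, so
   the Euclidean inner product and norm are defined here; the topology and the
   derivatives ('D_v, derivable) do not depend on the choice of norm. *)

Section Euclidean.
Variables (R : realType) (N : nat).
Implicit Types u v x : 'rV[R]_N.

Definition dotp u v : R := \sum_(i < N) u 0 i * v 0 i.

Definition enorm u : R := Num.sqrt (dotp u u).

Definition unit_vec (i : 'I_N) : 'rV[R]_N := delta_mx 0 i.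

Definition gradient (F : 'rV[R]_N -> R) x : 'rV[R]_N :=
  \row_(i < N) 'D_(unit_vec i) F x.

(* U is meant to be open. *)
Fixpoint class_C (k : nat) (U : set 'rV[R]_N) (F : 'rV[R]_N -> R) : Prop :=
  (forall x, U x -> {for x, continuous F}) /\
  (if k is k'.+1 then
     forall i : 'I_N, (forall x, U x -> derivable F x (unit_vec i)) /\
                      class_C k' U ('D_(unit_vec i) F)
   else True).

End Euclidean.

(* A function (or a vector field) on the sphere is represented by a function on
   R^N of which only the values on the sphere matter: every notion below goes
   through the pullback [radial] along the retraction x |-> x / |x| of
   R^N \ {0} onto the sphere. *)

Section Sphere.
Variables (R : realType) (N : nat).
Implicit Types (u v x : 'rV[R]_N) (f : 'rV[R]_N -> R).
Implicit Types X : 'rV[R]_N -> 'rV[R]_N.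

Definition sphere : set 'rV[R]_N := [set x | enorm x = 1].

Definition radial (T : Type) (f : 'rV[R]_N -> T) : 'rV[R]_N -> T :=
  fun x => f ((enorm x)^-1 *: x).

Definition sphere_C (k : nat) f : Prop :=
  class_C k [set x | x != 0] (radial f).

(* Orthogonal projection onto the tangent space at x, for x on the sphere. *)
Definition tproj x v : 'rV[R]_N := v - dotp v x *: x.

(* Gradient for the metric induced by R^N: the tangential part of the ambient
   gradient of an extension. *)
Definition sphere_grad f x : 'rV[R]_N := tproj x (gradient (radial f) x).

(* Levi-Civita connection of the induced metric: the tangential part of the
   ambient derivative of X in the tangent direction v. *)
Definition sphere_conn v X x : 'rV[R]_N := tproj x ('D_v (radial X) x).

(* Trace of v |-> sphere_conn v X x on the tangent space T at x.  For a linear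
   map L of T, the trace is the sum of <L (P e_i), P e_i> over the canonical
   basis (e_i) of R^N, where P is the orthogonal projection onto T. *)
Definition sphere_div X x : R :=
  \sum_(i < N) dotp (sphere_conn (tproj x (unit_vec R i)) X x)
                    (tproj x (unit_vec R i)).

Definition laplace_beltrami f x : R := sphere_div (sphere_grad f) x.

End Sphere.

(* The quantity gamma^2 w^2 + |grad' w|^2. *)
Definition energy (R : realType) (N : nat) (gamma : R) (w : 'rV[R]_N -> R)
    (x : 'rV[R]_N) : R :=
  gamma ^+ 2 * w x ^+ 2 + enorm (sphere_grad w x) ^+ 2.

(* The power terms use real powers with the convention 0 `^ a = 0 for a != 0;
   the nonlinearity |w|^(p-1) w thus takes the value 0 where w = 0, for every
   p >= 0. *)
Definition is_solution (R : realType) (N : nat) (gamma mu p q : R)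
    (w : 'rV[R]_N -> R) : Prop :=
  sphere_C 2 w /\
  forall x, @sphere R N x ->
    - laplace_beltrami w x + mu * w x
      - `|w x| `^ (p - 1) * w x * energy gamma w x `^ (q / 2) = 0.

Definition cstar (R : realType) (c1 c2 p q : R) : R :=
  if 1 <= p then c1 `^ (p + q - 1) else c2 `^ (p - 1) * c1 `^ q.

(* Main.v *)
Require Import Defs.
From mathcomp Require Import all_boot all_order all_algebra.
From mathcomp Require Import all_classical all_reals all_analysis.
From mathcomp Require Import ring lra.

(** The proof is a two-point maximum principle; write n = N - 1.  Suppose that
x <> y on the sphere maximise f1 (w y) + f2 (w x) - G h with h = 1 - <x, y>.  Move
x along a tangent vector e and y along the image of e under the reflection
exchanging x and y: the first order conditions give
|f1' grad w (y)| = |f2' grad w (x)| = |G'| sqrt (h (2 - h)), and the second order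
conditions, summed over a frame, bound
f1' Lap w (y) + f1'' |grad w (y)|^2 + f2' Lap w (x) + f2'' |grad w (x)|^2
by 4 G'' h (2 - h) + 2 G' (2 - h - n h).

With f1 = id, f2 = - id and G a multiple of h^((1 - d) / 2), a nonconstant w has
such a pair, and (n (1 - d) + mu) (w y - w x) is at most the difference of the
nonlinear terms at y and x.  As |grad w| is the same at both points, Bernoulli's
inequality bounds that difference by (p + q) gamma^(1 - p) c_* (w y - w x), which
contradicts the hypothesis for small d.  This needs p >= 1, or |w| >= c2 / gamma;
the latter holds when p < 1 and w has a constant sign, because the gradient
vanishes at the extrema.

If p < 1 and w changes sign, take f1 = ln and f2 = ln o (-).  The maximal pair has
|grad w| / |w| prescribed by G at both points, so the equation bounds
- Lap w / w from above by a function of h only, whereas the maximum principle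
bounds it from below.  The two are incompatible for a suitable G, of the form
h G' = a + b r / (r + 2) with r = (2 - h) / (n h); finding a and b is an inequality
in one real variable. *)

Set Implicit Arguments.
Unset Strict Implicit.
Unset Printing Implicit Defensive.

Import Order.TTheory GRing.Theory Num.Theory.
Import numFieldNormedType.Exports.

Local Open Scope classical_set_scope.
Local Open Scope ring_scope.

(** * Explicit bounds for the exponential and for the power (1 + X^2)^(k/2) *)

Section RealInequalities.
Variable R : realType.
Implicit Types t w x X k : R.

Lemma ge0_of_derive_ge0 (f df : R -> R) :
  (forall x, is_derive x 1 f (df x)) -> (forall x, 0 <= x -> 0 <= df x) ->
  0 <= f 0 -> forall x, 0 <= x -> 0 <= f x.
Proof.
move=> fdf df0 f0 x x0.
have [|c cx fE] := @MVT_segment _ f df 0 x x0 (fun y _ => fdf y).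
  apply: derivable_within_continuous => y _.
  exact: (@ex_derive _ _ _ _ _ _ _ (fdf y)).
have : 0 <= f x - f 0.
  by rewrite fE mulr_ge0 ?df0 ?subr0//; move: cx; rewrite in_itv/= => /andP[].
by rewrite subr_ge0; exact: le_trans.
Qed.

Lemma expRN_ge_cubic t : 0 <= t -> 1 - t + t ^+ 2 / 2 - t ^+ 3 / 6 <= expR (- t).
Proof.
move=> t0.
(* Up to sign, Taylor remainders of [expR (- x)]: each is the derivative of the next and all vanish
   at 0, so the sign of the first propagates to the last. *)
pose e1 x := 1 - expR (- x).
pose e2 x := expR (- x) - 1 + x.
pose e3 x := 1 - x + x ^+ 2 / 2 - expR (- x).
pose e4 x := expR (- x) - 1 + x - x ^+ 2 / 2 + x ^+ 3 / 6.
have dE x : is_derive x 1 (fun y : R => expR (- y)) (- expR (- x)).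
  have := is_derive1_comp (is_derive_expR (- x)) (is_deriveNid x (1 : R)).
  by rewrite mulrN1.
have e2_ge0 : forall x, 0 <= x -> 0 <= e2 x.
  apply: (@ge0_of_derive_ge0 _ e1) => [x|x x0|]; last first.
  - by rewrite /e2 oppr0 expR0 subrr addr0.
  - by rewrite /e1 subr_ge0 -expR0 ler_expR oppr_le0.
  - by rewrite /e2 /e1; apply: is_derive_eq; lra.
have e3_ge0 : forall x, 0 <= x -> 0 <= e3 x.
  apply: (@ge0_of_derive_ge0 _ e2) => [x|x x0|]; last first.
  - by rewrite /e3 oppr0 expR0; lra.
  - exact: e2_ge0.
  - rewrite /e3 /e2; apply: is_derive_eq.
    rewrite /GRing.scale/=; lra.
have e4_ge0 : forall x, 0 <= x -> 0 <= e4 x.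
  apply: (@ge0_of_derive_ge0 _ e3) => [x|x x0|]; last first.
  - by rewrite /e4 oppr0 expR0; lra.
  - exact: e3_ge0.
  - rewrite /e4 /e3; apply: is_derive_eq.
    rewrite /GRing.scale/=; lra.
have := e4_ge0 _ t0; rewrite /e4; lra.
Qed.

Lemma expR_ge_quartic t : 0 <= t ->
  1 + t + t ^+ 2 / 2 + t ^+ 3 / 6 + t ^+ 4 / 24 <= expR t.
Proof.
move=> t0.
apply: le_trans (nondecreasing_cvgn_le (nondecreasing_series
  (fun n _ _ => exp_coeff_ge0 n t0)) (is_cvg_series_exp_coeff t) 5).
rewrite /series/= exp_coeffE.
rewrite !big_mkord !big_ord_recr big_ord0/=.
by rewrite !factS fact0; lra.
Qed.

(** Young's inequality for the product of (1 + X)^k and 1, with the conjugate exponents 1/k and 1/(1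
    - k). *)
Lemma powR_le_affine X k : 0 <= X -> 0 < k -> k <= 1 ->
  (1 + X) `^ k <= 1 + k * X.
Proof.
move=> X0 k0; rewrite le_eqVlt => /predU1P[->|k1].
  by rewrite powRr1 ?mul1r// addr_ge0.
have k1' : 0 < 1 - k by rewrite subr_gt0.
have := @conjugate_powR R ((1 + X) `^ k) 1 k^-1 (1 - k)^-1.
rewrite !invr_gt0 !invrK -powRrM divff ?gt_eqF// powRr1 ?addr_ge0//.
rewrite powR1 mulr1 => H.
have := H (powR_ge0 _ _) ler01 k0 k1'; rewrite subrKC => /(_ erefl).
by lra.
Qed.

Lemma expR_le_inv_cubic t : 0 <= t <= 1 ->
  expR t * (1 - t + t ^+ 2 / 2 - t ^+ 3 / 6) <= 1.
Proof.
move=> /andP[t0 t1]; rewrite -[leRHS](expRxMexpNx_1 t) ler_wpM2l ?expR_ge0//.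
exact: expRN_ge_cubic.
Qed.

(** The exponent is halved because the cubic bound is sharp only for small arguments; [expR1_le]
    divides it by four for the same reason. *)
Lemma expR41_le : expR (41 / 100) <= 151 / 100 :> R.
Proof.
have /expR_le_inv_cubic : 0 <= (41 / 200 : R) <= 1 by apply/andP; split; lra.
have -> : 41 / 100 = 2%:R * (41 / 200) :> R by field.
rewrite (expRM_natl 2) => H.
have e0 := expR_ge0 (41 / 200 : R).
have : expR (41 / 200) <= 43 / 35 :> R by lra.
by nra.
Qed.

Lemma expR1_le : expR 1 <= 41 / 15 :> R.
Proof.
have /expR_le_inv_cubic : 0 <= (1 / 4 : R) <= 1 by apply/andP; split; lra.
have -> : expR 1 = (expR (1 / 4) ^+ 2) ^+ 2 :> R.
  by rewrite -!exprM -(expRM_natl 4); congr expR; field.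
have e0 := expR_ge0 (1 / 4 : R).
set e := expR (1 / 4) in e0 * => H.
have He : e <= 9 / 7 by lra.
have e2 : e ^+ 2 <= 81 / 49 by nra.
by have := sqr_ge0 e; nra.
Qed.

Lemma sqr_le_expR X : 0 <= X -> 1 + X ^+ 2 <= expR (82 / 100 * X).
Proof.
move=> X0; apply: le_trans (expR_ge_quartic _); last by rewrite mulr_ge0.
suff : 0 <= X * (82 / 100 + ((82 / 100) ^+ 2 / 2 - 1) * X
    + (82 / 100) ^+ 3 / 6 * X ^+ 2 + (82 / 100) ^+ 4 / 24 * X ^+ 3) by lra.
rewrite mulr_ge0//.
(* The cubic left after factoring out X has a barely positive minimum near 2.17; squares centred
   nearby certify its sign. *)
have : 0 <= (X - 219 / 100) ^+ 2 by rewrite sqr_ge0.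
have : 0 <= X * (X - 219 / 100) ^+ 2 by rewrite mulr_ge0// sqr_ge0.
nra.
Qed.

Lemma pow_half_le_expR X k : 0 <= X -> 0 <= k ->
  (1 + X ^+ 2) `^ (k / 2) <= expR (41 / 100 * (k * X)).
Proof.
move=> X0 k0.
rewrite (_ : 41 / 100 * _ = 82 / 100 * X * (k / 2)); last by field.
rewrite expRM ge0_ler_powR ?nnegrE ?addr_ge0 ?sqr_ge0 ?expR_ge0 ?divr_ge0//.
exact: sqr_le_expR.
Qed.

Lemma expR_chord c t : 0 <= t <= 1 -> expR (c * t) <= 1 + (expR c - 1) * t \/ c < 0.
Proof.
move=> /andP[t0 t1]; have [c0|] := leP 0 c; [left|by right].
move: t0; rewrite le_eqVlt => /predU1P[<-|t0]; first by rewrite !mulr0 expR0 addr0.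
rewrite expRM -[X in X `^ t](subrKC 1).
rewrite (le_trans (powR_le_affine _ t0 t1)) ?[t * _]mulrC//.
by rewrite subr_ge0 -expR0 ler_expR.
Qed.

(** This lemma, [pow_half_medium] and [pow_half_large] give affine majorants in w = k X, for w <= 1,
    1 <= w <= 2 and w >= 2. The first two come from chords of expR (0.41 w), with constants rounded
    up. *)
Lemma pow_half_small X k (w := k * X) : 0 <= X -> 0 <= k -> w <= 1 ->
  (1 + X ^+ 2) `^ (k / 2) <= 1 + 51 / 100 * w.
Proof.
move=> X0 k0 w1; apply: (le_trans (pow_half_le_expR X0 k0)).
have w0 : 0 <= w by rewrite mulr_ge0.
have /(expR_chord (41 / 100))[|] : 0 <= w <= 1 by rewrite w0.
  by have := expR41_le; nra.
by lra.
Qed.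

Lemma pow_half_medium X k (w := k * X) : 0 <= X -> 0 <= k -> 1 <= w <= 2 ->
  (1 + X ^+ 2) `^ (k / 2) <= 74 / 100 + 771 / 1000 * w.
Proof.
move=> X0 k0 /andP[w1 w2]; apply: (le_trans (pow_half_le_expR X0 k0)).
rewrite -/w (_ : 41 / 100 * w = 41 / 100 + 41 / 100 * (w - 1)); last by field.
rewrite expRD.
have := expR41_le; have := expR_ge0 (41 / 100 * (w - 1)).
have := expR_gt0 (41 / 100 : R).
have /(expR_chord (41 / 100))[|] : 0 <= w - 1 <= 1 by apply/andP; split; lra.
  2: lra.
set a := expR (41 / 100); set b := expR _ => b1 a0 b0 a1.
have : b <= 1 + 51 / 100 * (w - 1) by nra.
by nra.
Qed.

(** With u = 0.205 w, the cubic [c] satisfies expR u * c <= 1, so the claim (expR u)^2 <= p reduces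
    to the polynomial inequality 1 <= p c^2. *)
Lemma pow_half_quadratic X k (w := k * X) : 0 <= X -> 0 <= k -> w <= 2 ->
  (1 + X ^+ 2) `^ (k / 2) <= 1 + 42 / 100 * w + 12 / 100 * w ^+ 2.
Proof.
move=> X0 k0 w2; apply: (le_trans (pow_half_le_expR X0 k0)).
have w0 : 0 <= w by rewrite mulr_ge0.
rewrite -/w (_ : 41 / 100 * w = 2%:R * (41 / 200 * w)); last by field.
rewrite (expRM_natl 2).
set u := 41 / 200 * w.
have u0 : 0 <= u by rewrite mulr_ge0.
have u1 : u <= 41 / 100 by rewrite /u; lra.
have /expR_le_inv_cubic : 0 <= u <= 1 by apply/andP; split; lra.
set c := 1 - u + _ - _ => ec.
have e0 := expR_ge0 u.
have c0 : 0 < c.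
  have : u ^+ 3 <= (41 / 100) ^+ 2 * u by rewrite exprS mulrC ler_wpM2r// lerXn2r ?nnegrE.
  by rewrite /c; have := sqr_ge0 u; lra.
have -> : w = 200 / 41 * u by rewrite /u; field.
set p := 1 + _ + _.
suff pc : 1 <= p * c ^+ 2.
  rewrite -(ler_pM2r (exprn_gt0 2 c0)); apply: le_trans pc.
  by rewrite -exprMn expr_le1// mulr_ge0// ltW.
have v0 : 0 <= 41 / 100 - u by lra.
(* As u <= 0.41, the cubic term of [c] is absorbed by the quadratic one. *)
have cu : 1 - u + 43 / 100 * u ^+ 2 <= c.
  by rewrite /c; have := mulr_ge0 (sqr_ge0 u) v0; nra.
have c1 : 0 <= 1 - u + 43 / 100 * u ^+ 2 by have := sqr_ge0 u; lra.
have p0 : 0 <= p by rewrite /p; have := sqr_ge0 (200 / 41 * u); lra.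
apply: (@le_trans _ _ (p * (1 - u + 43 / 100 * u ^+ 2) ^+ 2)); last first.
  by rewrite ler_wpM2l// lerXn2r// nnegrE// ltW.
have u3 : 0 <= u ^+ 3 by rewrite exprn_ge0.
have u4 : 0 <= u ^+ 4 by rewrite exprn_ge0.
have u5 : 0 <= u ^+ 5 by rewrite exprn_ge0.
have h4 := mulr_ge0 u4 v0.
have h5 := mulr_ge0 u5 v0.
have h3 := mulr_ge0 u3 v0.
have h2 := mulr_ge0 (sqr_ge0 u) v0.
have h1 := mulr_ge0 u0 v0.
have hh := mulr_ge0 u0 (sqr_ge0 (u - 41 / 100)).
rewrite /p; nra.
Qed.

End RealInequalities.

(** * The affine majorant for large w, and how an affine majorant is used *)

Section BernsteinForms.
Variable R : realType.
Implicit Types t w x X k : R.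

(** Write k = 1/(1 + i) and X = (1 + i) w. With y = w + 0.29 and t = ln y, the claim is 1 + (1 +
    i)^2 w^2 <= y^2 expR (2 i t). Expanding the exponential to second order and comparing the
    coefficients of 1, i and i^2 leaves 1 + w^2 <= y^2, w^2 <= t y^2 and w^2 <= 2 t^2 y^2. *)
Lemma pow_half_large X k (w := k * X) : 0 <= X -> 0 < k -> k <= 1 -> 2 <= w ->
  (1 + X ^+ 2) `^ (k / 2) <= 29 / 100 + w.
Proof.
move=> X0 k0 k1 w2; have wE : w = k * X by []; clearbody w.
set y := 29 / 100 + w.
have y0 : 0 < y by rewrite /y; lra.
have expl : expR (ln y) = y by rewrite lnK.
have [i i0 XE] : exists2 i, 0 <= i & X = (1 + i) * w.
  exists (k^-1 - 1); first by rewrite subr_ge0 invf_ge1.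
  by rewrite wE subrKC mulrA mulVf ?mul1r ?gt_eqF.
have kE : k * (1 + i) = 1.
  have w0 : w != 0 by rewrite gt_eqF//; lra.
  by apply: (mulIf w0); rewrite -mulrA -XE mul1r.
set t := ln y in expl *.
(* Here t >= 0.82 because expR 0.82 <= 1.51^2 <= 2.29 <= y, and t >= 1 once w exceeds 2.45; the two
   ranges of w are treated separately. *)
have [t0 ty] : 1 / 2 <= t /\ w ^+ 2 <= t * y ^+ 2.
  have [w1|w1] := leP w (245 / 100).
    have t1 : 82 / 100 <= t.
      rewrite -ler_expR expl (_ : 82 / 100 = 2%:R * (41 / 100)); last by field.
      rewrite (expRM_natl 2); have e0 := expR_ge0 (41 / 100 : R).
      have := ler_pM e0 e0 (expR41_le R) (expR41_le R).
      by rewrite -expr2 /y; lra.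
    split; first lra.
    apply: (@le_trans _ _ (82 / 100 * y ^+ 2)); last by rewrite ler_wpM2r ?sqr_ge0.
    have : 0 <= (w - 2) * (245 / 100 - w) by rewrite mulr_ge0 ?subr_ge0.
    by rewrite /y; lra.
  have t1 : 1 <= t by rewrite -ler_expR expl; have := expR1_le R; rewrite /y; lra.
  split; first lra.
  apply: (@le_trans _ _ (1 * y ^+ 2)); last by rewrite ler_wpM2r ?sqr_ge0.
  by rewrite /y; nra.
suff XT : 1 + X ^+ 2 <= expR (2 * (1 + i) * t).
  rewrite -[leRHS]expl (_ : t = 2 * (1 + i) * t * (k / 2)); last first.
    by transitivity (k * (1 + i) * t); [rewrite kE mul1r|field].
  by rewrite expRM ge0_ler_powR ?nnegrE ?addr_ge0 ?sqr_ge0 ?expR_ge0 ?divr_ge0// ltW.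
have -> : 2 * (1 + i) * t = 2%:R * t + 2 * i * t by ring.
rewrite expRD (expRM_natl 2) expl XE.
have it0 : 0 <= i * t by rewrite mulr_ge0//; lra.
apply: (@le_trans _ _ (y ^+ 2 * (1 + 2 * (i * t) + 2 * (i * t) ^+ 2))); last first.
  rewrite ler_wpM2l ?sqr_ge0//; apply: le_trans (expR_ge_quartic _); last first.
    by rewrite -mulrA mulr_ge0.
  have := exprn_ge0 3 it0; have := exprn_ge0 4 it0; lra.
have h1 : 0 <= i * (t * y ^+ 2 - w ^+ 2) by rewrite mulr_ge0// subr_ge0.
have h2 : w ^+ 2 <= 2 * (t ^+ 2 * y ^+ 2).
  have : 0 <= (t - 1 / 2) * (t * y ^+ 2) by rewrite !mulr_ge0 ?sqr_ge0//; lra.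
  lra.
have h3 : 0 <= i ^+ 2 * (2 * (t ^+ 2 * y ^+ 2) - w ^+ 2).
  by rewrite mulr_ge0 ?sqr_ge0// subr_ge0.
have h4 : 1 + w ^+ 2 <= y ^+ 2 by rewrite /y; nra.
lra.
Qed.

(** Since d <= 1 and m >= 0, d l - m <= d (l - m) <= d e. *)
Lemma linear_perturbation (l m e d c P w : R) : 0 <= l -> l - m <= e -> 0 <= m ->
  0 <= d <= 1 -> P <= d + c * w -> l * P - m <= d * e + c * (l * w).
Proof.
move=> l0 le m0 /andP[d0 d1] Pw.
have : 0 <= l * (d + c * w - P) by rewrite mulr_ge0// subr_ge0.
have : 0 <= d * (e - (l - m)) by rewrite mulr_ge0// subr_ge0.
have : 0 <= (1 - d) * m by rewrite mulr_ge0// subr_ge0.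
lra.
Qed.


End BernsteinForms.

(** * Positivity certificates for the three affine majorants *)

Section Margins.
Variable R : realType.
Implicit Types t w x X k : R.

(* [B0], [B1], [B2] are coefficients in the Bernstein basis of [0, 1/2]. *)
Lemma bernstein_gt0 (P B0 B1 B2 e : R) : 0 < e -> e <= 1 / 2 ->
  P = (1 - 2 * e) ^+ 2 * B0 + 4 * e * (1 - 2 * e) * B1 + 4 * e ^+ 2 * B2 ->
  0 <= B0 -> 0 < B1 -> 0 < B2 -> 0 < P.
Proof.
move=> e0 e1 -> b0 b1 b2.
have e2 : 0 < 4 * e ^+ 2 * B2 by rewrite !mulr_gt0// exprn_gt0.
rewrite ltr_wpDl// addr_ge0// mulr_ge0 ?sqr_ge0//; last exact: ltW.
by rewrite !mulr_ge0//; lra.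
Qed.

(* [margin d c e z / q ^ 2] is the gap in the supersolution inequality for
   [nu (5/4 e) (3/4 - 6/5 e) = M / q] once the power on its left-hand side has
   been replaced by an affine upper bound [d + c * w]; here [e] is [1 - x]. *)
Definition margin (d c e z : R) : R :=
  let a := 5 / 4 * e in let b := 3 / 4 - 6 / 5 * e in
  let q := z ^+ 2 + 2 in let M := a * q + b * z ^+ 2 in
  M * (q - M) * z ^+ 2 + M * q + 4 * b * z ^+ 4
  - d * e * q ^+ 2 - 2 * c * (1 - e) * z * M * q.

Lemma nneg_monomial_sqr (z r : R) j : 0 <= z -> 0 <= z ^+ j * (z - r) ^+ 2.
Proof. by move=> z0; rewrite mulr_ge0 ?sqr_ge0// exprn_ge0. Qed.

(* The Bernstein coefficients of [margin] are nonnegative combinations of the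
   monomials and of these [z ^ j (z - r) ^ 2]; the roots were found numerically. *)
Ltac sextic z0 :=
  let h := fresh "h" in
  have h := fun j r => nneg_monomial_sqr r j z0;
  have := h 0 (1/4); have := h 0 (1/2); have := h 0 1; have := h 0 2;
  have := h 0 (16/31); have := h 2 (9/16); have := h 4 (5/2);
  have := h 0 (3/4); have := h 1 (3/4); have := h 2 (3/4);
  have := h 3 (3/4); have := h 4 (3/4); have := h 4 3; have := h 3 3;
  have := h 2 3; have := h 0 (5/8); have := h 2 (7/8);
  have := h 1 (1/4); have := h 1 (1/2); have := h 1 1; have := h 1 2;
  have := h 2 (1/4); have := h 2 (1/2); have := h 2 1; have := h 2 2;
  have := h 2 4;
  have := h 3 (1/4); have := h 3 (1/2); have := h 3 1; have := h 3 2;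
  have := h 3 4;
  have := h 4 (1/2); have := h 4 1; have := h 4 2; have := h 4 4;
  have := exprn_ge0 1 z0; have := exprn_ge0 2 z0; have := exprn_ge0 3 z0;
  have := exprn_ge0 4 z0; have := exprn_ge0 5 z0; have := exprn_ge0 6 z0;
  clear h; move=> *; lra.

(** In e, [margin] is a quadratic polynomial; the three sextics in z given below are its Bernstein
    coefficients. This case serves w <= 1, the next two 1 <= w <= 2 and w >= 2. *)
Lemma margin_line1 e z : 0 < e -> e <= 1 / 2 -> 0 <= z -> 0 < margin 1 (13 / 25) e z.
Proof.
move=> e0 e1 z0; apply: (@bernstein_gt0 _
  (3 / 2 * z ^+ 2 - 39 / 25 * z ^+ 3 + 21 / 4 * z ^+ 4 - 39 / 50 * z ^+ 5
    + 3 / 16 * z ^+ 6)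
  (1 / 4 - 13 / 10 * z + 12 / 5 * z ^+ 2 - 923 / 500 * z ^+ 3
    + 141 / 40 * z ^+ 4 - 299 / 500 * z ^+ 5 + 29 / 160 * z ^+ 6)
  (1 / 2 - 13 / 10 * z + 139 / 80 * z ^+ 2 - 182 / 125 * z ^+ 3
    + 139 / 80 * z ^+ 4 - 403 / 1000 * z ^+ 5 + 279 / 1600 * z ^+ 6) e).
- exact: e0.
- exact: e1.
- by rewrite /margin; lra.
- by sextic z0.
- by sextic z0.
- by sextic z0.
Qed.

Lemma margin_line2 e z : 0 < e -> e <= 1 / 2 -> 0 <= z ->
  0 < margin (3 / 4) (31 / 40) e z.
Proof.
move=> e0 e1 z0; apply: (@bernstein_gt0 _
  (3 / 2 * z ^+ 2 - 93 / 40 * z ^+ 3 + 21 / 4 * z ^+ 4 - 93 / 80 * z ^+ 5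
    + 3 / 16 * z ^+ 6)
  (1 / 2 - 31 / 16 * z + 53 / 20 * z ^+ 2 - 2201 / 800 * z ^+ 3
    + 287 / 80 * z ^+ 4 - 713 / 800 * z ^+ 5 + 29 / 160 * z ^+ 6)
  (1 - 31 / 16 * z + 179 / 80 * z ^+ 2 - 217 / 100 * z ^+ 3
    + 149 / 80 * z ^+ 4 - 961 / 1600 * z ^+ 5 + 279 / 1600 * z ^+ 6) e).
- exact: e0.
- exact: e1.
- by rewrite /margin; lra.
- by sextic z0.
- by sextic z0.
- by sextic z0.
Qed.

Lemma margin_line3 e z : 0 < e -> e <= 1 / 2 -> 0 <= z -> 0 < margin (3 / 10) 1 e z.
Proof.
move=> e0 e1 z0; apply: (@bernstein_gt0 _
  (3 / 2 * z ^+ 2 - 3 * z ^+ 3 + 21 / 4 * z ^+ 4 - 3 / 2 * z ^+ 5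
    + 3 / 16 * z ^+ 6)
  (19 / 20 - 5 / 2 * z + 31 / 10 * z ^+ 2 - 71 / 20 * z ^+ 3
    + 37 / 10 * z ^+ 4 - 23 / 20 * z ^+ 5 + 29 / 160 * z ^+ 6)
  (19 / 10 - 5 / 2 * z + 251 / 80 * z ^+ 2 - 14 / 5 * z ^+ 3
    + 167 / 80 * z ^+ 4 - 31 / 40 * z ^+ 5 + 279 / 1600 * z ^+ 6) e).
- exact: e0.
- exact: e1.
- by rewrite /margin; lra.
- by sextic z0.
(* Squares with a zero at 3/5, close to the minimiser of this coefficient, are added to the
   certificate. *)
- have g j r r' : 0 <= z ^+ j * ((z - r) * (z - r')) ^+ 2.
    by rewrite mulr_ge0 ?sqr_ge0// exprn_ge0.
  have := g 0 (3/5) (3/5); have := g 0 (3/5) 2; have := g 0 (3/5) 3.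
  have := g 0 (3/5) 5; have := g 2 (3/5) 2; have := g 2 (3/5) 3; have := g 2 (3/5) 4.
  have := g 1 (3/5) 2; have := g 1 (3/5) 3; have := g 1 (3/5) 4.
  have := g 2 (3/5) (3/5); have := g 1 (3/5) (3/5).
  clear g; sextic z0.
- by sextic z0.
Qed.


End Margins.

(** * The one-variable inequality that selects the profile [nu] *)

Section Supersolution.
Variable R : realType.
Implicit Types t w x X k : R.

(* [nu] is [h * G' h] for the function [G] of the two-point maximum; [r] is
   [cot (theta / 2) ^ 2 / n] for two points at angle [theta]. *)
Definition nu (a b r : R) : R := a + b * (r / (r + 2)).

Lemma nu_cst a r : nu a 0 r = a.
Proof. by rewrite /nu mul0r addr0. Qed.

(** Used with l = L/n, m = mu/n, s = sqrt n / gamma and k = 1 - p. Times n, the left-hand side then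
    bounds - Lap w / w from above at each point of the logarithmic maximal pair, and the right-hand
    side bounds the mean of its two values from below. The profile is constant, b = 0, unless l k s
    > 1 and l > m. *)
Lemma supersolution_scaled l m k s (P := fun z u => (1 + (s * (u * z)) ^+ 2) `^ (k / 2)) :
  0 < l -> 0 <= m -> 0 < k -> k <= 1 -> 0 < s -> l * (1 + k * s / 2) < 1 + m ->
  exists ab : R * R,
  [/\ 0 < ab.1, 0 <= ab.2, ab.1 + ab.2 < 1 &
   forall z, 0 <= z -> let u := nu ab.1 ab.2 (z ^+ 2) in
     l * P z u - m <
     u * (1 - u) * z ^+ 2 + u + 4 * ab.2 * (z ^+ 2) ^+ 2 / (z ^+ 2 + 2) ^+ 2].
Proof.
move=> l0 m0 k0 k1 s0 lm.
pose x := l * k * s / 2.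
have x0 : 0 < x by rewrite /x !mulr_gt0.
have lx : l - m < 1 - x by rewrite /x; lra.
have [ml|ml] := leP l m.
  (* This constant makes u (1 - u) z^2 equal to the quadratic term of Bernoulli's bound on l P; what
     remains is l - m <= 0 < u. *)
  exists ((1 + x * s)^-1, 0) => /=.
  have D0 : 0 < 1 + x * s by rewrite addr_gt0// mulr_gt0.
  split => //; first by rewrite invr_gt0.
    by rewrite addr0 invf_lt1// ltrDl mulr_gt0.
  move=> z z0; rewrite nu_cst mulr0 !mul0r addr0.
  set u := (1 + x * s)^-1; have u0 : 0 < u by rewrite invr_gt0.
  have PX : P z u <= 1 + k / 2 * (s * (u * z)) ^+ 2.
    by apply: powR_le_affine; [exact: sqr_ge0|lra|lra].
  have -> : 1 - u = x * s * u by rewrite /u; field; rewrite gt_eqF.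
  have := ler_wpM2l (ltW l0) PX.
  by rewrite /x; nra.
pose e := 1 - x.
have e0 : 0 < e by rewrite /e; lra.
have [x2|x2] := leP x (1 / 2).
  have n0 : 0 < 1 - 3 / 4 * x by lra.
  (* With this constant and the bound on l P - m below, the claim follows from positivity of 0.71
     T^2 - 0.84 T + 0.25, whose discriminant is negative. *)
  exists (1 - 3 / 4 * x, 0); split => //=; first lra.
  move=> z z0; rewrite nu_cst mulr0 !mul0r addr0.
  set u := 1 - 3 / 4 * x; pose T := u * z.
  have T0 : 0 <= T by rewrite mulr_ge0// ltW.
  have sT0 : 0 <= s * T by rewrite mulr_ge0// ltW.
  pose V := 2 * x * T.
  have VE : V = l * (k * (s * T)) by rewrite /V /x; field.
  suff PV : l * P z u - m <= e + 42 / 100 * V + 12 / 100 * (V ^+ 2 / e).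
    apply: le_lt_trans PV _.
    have -> : u * (1 - u) * z ^+ 2 = 3 * x / (4 - 3 * x) * T ^+ 2.
      by rewrite /T /u; field; rewrite gt_eqF//; lra.
    have AB : 71 / 100 <= 3 / (4 - 3 * x) - 48 / 100 * (x / e).
      rewrite lerBrDr; have d0 : 0 < (4 - 3 * x) * e by rewrite mulr_gt0//; lra.
      rewrite -(ler_pM2r d0) -subr_ge0.
      rewrite (_ : _ - _ = 3 * e - 71 / 100 * ((4 - 3 * x) * e)
        - 48 / 100 * x * (4 - 3 * x)); last by rewrite /e; field; rewrite !gt_eqF//; lra.
      by rewrite /e; nra.
    have -> : 12 / 100 * (V ^+ 2 / e) = x * (48 / 100 * (x / e)) * T ^+ 2.
      by rewrite /V; field; rewrite gt_eqF.
    have : 0 <= (3 / (4 - 3 * x) - 48 / 100 * (x / e) - 71 / 100) * T ^+ 2.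
      by rewrite mulr_ge0 ?sqr_ge0// subr_ge0.
    have -> : 3 * x / (4 - 3 * x) = x * (3 / (4 - 3 * x)) by rewrite [3 * x]mulrC mulrA.
    set A := 3 / _; set B := _ * (x / e) => ABT.
    rewrite -subr_gt0.
    rewrite (_ : _ - _ = x * ((A - B) * T ^+ 2 - 84 / 100 * T + 1 / 4)); last first.
      by rewrite /u /e /V; field.
    by rewrite mulr_gt0//; have := sqr_ge0 (T - 42 / 71); lra.
  have [w2|w2] := leP (k * (s * T)) 2.
    have Pw := pow_half_quadratic sT0 (ltW k0) w2.
    have := ler_wpM2l (ltW l0) Pw; rewrite -/(P z u).
    set w := k * (s * T) in VE w2 * => H.
    have w0 : 0 <= w by rewrite !mulr_ge0// ltW.
    have [el|le] := leP e l.
      have : V ^+ 2 / l <= V ^+ 2 / e by rewrite ler_wpM2l ?sqr_ge0// lef_pV2.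
      rewrite (_ : V ^+ 2 / l = l * w ^+ 2); last by rewrite VE; field; rewrite gt_eqF.
      by rewrite VE /e; lra.
    (* This quotient is exactly the excess of e + 0.12 V^2 / e over l + 0.12 l w^2; it is
       nonnegative because w <= 2. *)
    have : 0 <= (e - l) * (e - 12 / 100 * l * w ^+ 2) / e.
      have le0 : 0 <= e - l by rewrite subr_ge0 ltW.
      have lw : l * w ^+ 2 <= e * w ^+ 2 by rewrite ler_wpM2r ?sqr_ge0// ltW.
      have w4 : w ^+ 2 <= 4.
        by have := ler_pM w0 w0 w2 w2; rewrite -expr2; lra.
      have ew := ler_wpM2l (ltW e0) w4.
      by rewrite divr_ge0 ?(ltW e0)// mulr_ge0//; lra.
    have -> : (e - l) * (e - 12 / 100 * l * w ^+ 2) / e =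
        e - l - 12 / 100 * l * w ^+ 2 + 12 / 100 * (V ^+ 2 / e).
      by rewrite VE; field; rewrite gt_eqF.
    by rewrite VE; lra.
  have Pw := pow_half_large sT0 k0 k1 (ltW w2).
  rewrite -/(P z u) -[X in _ + X]mul1r in Pw.
  have d01 : 0 <= (29 / 100 : R) <= 1 by apply/andP; split; lra.
  apply: le_trans (linear_perturbation (ltW l0) (ltW lx) m0 d01 Pw) _.
  rewrite -VE -/e -subr_ge0.
  rewrite (_ : _ - _ = (12 / 100 * V ^+ 2 - 58 / 100 * (V * e)
    + 71 / 100 * e ^+ 2) / e); last by field; rewrite gt_eqF.
  by rewrite divr_ge0 ?(ltW e0)//; have := sqr_ge0 (V - 29 / 12 * e); nra.
(* At z = 0 the inequality is l - m < a, whence a slightly above e; a + b = 3/4 + e/20 stays below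
   1. *)
exists (5 / 4 * e, 3 / 4 - 6 / 5 * e) => /=.
have e2 : e <= 1 / 2 by rewrite /e; lra.
split; [lra|lra|lra|].
move=> z z0.
set a := 5 / 4 * e; set b := 3 / 4 - 6 / 5 * e; set u := nu a b (z ^+ 2).
have a0 : 0 < a by rewrite /a; lra.
have b0 : 0 < b by rewrite /b; lra.
pose q := z ^+ 2 + 2; have q0 : 0 < q by rewrite /q ltr_wpDl ?sqr_ge0.
pose M := a * q + b * z ^+ 2.
have uE : u = M / q by rewrite /u /nu /M -/q; field; rewrite gt_eqF.
have u0 : 0 <= u.
  have M0 : 0 <= M.
    by rewrite /M addr_ge0// mulr_ge0 ?sqr_ge0//; exact: ltW.
  by rewrite uE divr_ge0// ltW.
pose T := u * z; have T0 : 0 <= T by rewrite mulr_ge0.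
have sT0 : 0 <= s * T by rewrite mulr_ge0// ltW.
have w0 : 0 <= k * (s * T) by rewrite mulr_ge0// ltW.
have VE : l * (k * (s * T)) = 2 * x * T by rewrite /x; field.
have main d c : 0 <= d <= 1 -> 0 < margin d c e z ->
    P z u <= d + c * (k * (s * T)) ->
    l * P z u - m <
    u * (1 - u) * z ^+ 2 + u + 4 * b * (z ^+ 2) ^+ 2 / (z ^+ 2 + 2) ^+ 2.
  move=> d01 mpos Pw.
  apply: le_lt_trans (linear_perturbation (ltW l0) (ltW lx) m0 d01 Pw) _.
  rewrite VE -/e -subr_gt0 -/q.
  rewrite (_ : _ - _ = margin d c e z / q ^+ 2).
    by rewrite divr_gt0// exprn_gt0.
  rewrite /margin -/a -/b -/q -/M /T uE (_ : x = 1 - e); last by rewrite /e; ring.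
  by field; rewrite gt_eqF.
have [w1|w1] := leP (k * (s * T)) 1.
  apply: (main 1 (13 / 25)) (margin_line1 e0 e2 z0) _.
    by rewrite ler01 lexx.
  by apply: le_trans (pow_half_small sT0 (ltW k0) w1) _; lra.
have [w2|w2] := leP (k * (s * T)) 2.
  apply: (main (3 / 4) (31 / 40)) (margin_line2 e0 e2 z0) _.
    by apply/andP; split; lra.
  have w12 : 1 <= k * (s * T) <= 2 by rewrite (ltW w1).
  by apply: le_trans (pow_half_medium sT0 (ltW k0) w12) _; lra.
apply: (main (3 / 10) 1) (margin_line3 e0 e2 z0) _.
  by apply/andP; split; lra.
by apply: le_trans (pow_half_large sT0 k0 k1 (ltW w2)) _; lra.
Qed.


End Supersolution.

(** * Directional derivatives along lines *)

Lemma is_derive_cvg (R : realType) (V W : normedModType R) (f : V -> W) (x v : V) d :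
  h^-1 *: (f (h *: v + x) - f x) @[h --> 0^'] --> d -> is_derive x v f d.
Proof. by move=> fd; split; [exact: (cvgP d) | exact: cvg_lim]. Qed.

Lemma mvt_abs (R : realType) (g dg : R -> R) (s : R) :
  (forall y : R, `|y| <= `|s| -> is_derive y 1 g (dg y)) ->
  exists2 y, `|y| <= `|s| & g s - g 0 = dg y * s.
Proof.
move=> gd; have [s0|s0] := leP 0 s.
  have [||y] := @MVT_segment _ g dg 0 s s0.
  - move=> y; rewrite in_itv/= => /andP[y0 ys]; apply: gd.
    by rewrite !ger0_norm// ltW.
  - apply: derivable_within_continuous => y; rewrite in_itv/= => /andP[y0 ys].
    by apply: (@ex_derive _ _ _ _ _ _ _ (gd y _)); rewrite !ger0_norm.
  rewrite in_itv/= subr0 => /andP[y0 ys] ->.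
  by exists y => //; rewrite !ger0_norm.
have [||y] := @MVT_segment _ g dg s 0 (ltW s0).
- move=> y; rewrite in_itv/= => /andP[y0 ys]; apply: gd.
  by rewrite !ler0_norm ?lerN2// ltW.
- apply: derivable_within_continuous => y; rewrite in_itv/= => /andP[y0 ys].
  by apply: (@ex_derive _ _ _ _ _ _ _ (gd y _)); rewrite !ler0_norm ?lerN2// ltW.
rewrite in_itv/= => /andP[y0 ys] E.
exists y; first by rewrite !ler0_norm ?lerN2// ltW.
by rewrite -opprB E; ring.
Qed.

Section DirectionalDerivatives.
Variables (R : realType) (V : normedModType R).
Implicit Types (F : V -> R) (x u v : V).

Lemma is_derive_lineP F x v (t d : R) :
  is_derive t 1 (fun s : R => F (x + s *: v)) d <-> is_derive (x + t *: v) v F d.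
Proof.
have E : (fun h : R => h^-1 *: (((fun s : R => F (x + s *: v)) \o shift t) (h *: (1 : R))
           - F (x + t *: v))) =
         (fun h : R => h^-1 *: ((F \o shift (x + t *: v)) (h *: v) - F (x + t *: v))).
  apply/funext => h /=; congr (_ *: (F _ - _)).
  by rewrite scalerDl [h *: (1 : R)]mulr1 addrCA.
split=> -[h1 h2]; split; rewrite /derivable/derive.
- by move: h1; rewrite /derivable E.
- by rewrite -h2 /derive E.
- by rewrite E.
- by rewrite E.
Qed.

Lemma is_derive_line0 F x v (d : R) :
  is_derive (0 : R) 1 (fun s : R => F (x + s *: v)) d <-> is_derive x v F d.
Proof. by rewrite is_derive_lineP scale0r addr0. Qed.

Lemma is_derive_scalev F x v (c d : R) :
  is_derive x v F d -> is_derive x (c *: v) F (c * d).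
Proof.
move=> /is_derive_line0 H; apply/is_derive_line0.
have H2 : is_derive (0 * c) 1 (fun s : R => F (x + s *: v)) d by rewrite mul0r.
have := @is_derive1_comp _ (fun s : R => F (x + s *: v)) (fun s : R => s * c) 0 d c H2.
rewrite mulrC => H3.
rewrite (_ : (fun s : R => F (x + s *: (c *: v))) =
   (fun s : R => F (x + s *: v)) \o (fun s : R => s * c)).
  apply: H3; apply: is_derive_eq.
  by rewrite scaler0 add0r /GRing.scale/= mulr1.
by apply/funext => s /=; rewrite scalerA.
Qed.

(** The increment along s (u + c e) splits into one along s u and one along s c e; the mean value
    theorem and the continuity of the derivative along e evaluate the second. Iterated over
    coordinates in [class_C1_is_derive]. *)
Lemma is_derive_addv F x u e (c d : R) :
  is_derive x u F d -> (\forall z \near x, derivable F z e) ->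
  {for x, continuous ('D_e F)} ->
  is_derive x (u + c *: e) F (d + c * 'D_e F x).
Proof.
move=> Fu Fe De; apply/is_derive_line0.
rewrite (_ : (fun s : R => _) = (fun s : R => F (x + s *: u)) \+
   (fun s : R => F (x + s *: u + (s * c) *: e) - F (x + s *: u))); last first.
  by apply/funext => s /=; rewrite [RHS]addrC subrK scalerDr scalerA addrA.
apply: is_deriveD; first exact/is_derive_line0.
set H := fun s : R => _ - _.
apply: is_derive_cvg; apply/cvgrPdist_le => eps eps0.
pose eps1 := eps / (`|c| + 1).
have c1 : 0 < `|c| + 1 by rewrite ltr_wpDl.
have eps1_gt0 : 0 < eps1 by rewrite divr_gt0.
have De1 : \forall z \near x, derivable F z e /\ `|'D_e F x - 'D_e F z| <= eps1.
  by apply: filterI => //; move/cvgrPdist_le : De; exact.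
move/nbhs_normP : De1 => [/= dlt dlt0 Hdlt].
pose K := `|u| + `|c| * `|e| + 1.
have K0 : 0 < K by rewrite ltr_wpDl ?addr_ge0 ?mulr_ge0.
near=> s.
have s0 : s != 0 by near: s; exact: nbhs_dnbhs_neq.
have sK : `|s| * K < dlt.
  rewrite -ltr_pdivlMr//; near: s; apply: dnbhs0_lt; exact: divr_gt0.
have near_x (y : R) : `|y| <= `|s * c| -> `|x - (x + s *: u + y *: e)| < dlt.
  move=> ysc; apply: le_lt_trans sK.
  rewrite -addrA opprD addrA subrr add0r normrN.
  apply: le_trans (ler_normD _ _) _; rewrite !normrZ mulrDr mulrDr mulr1.
  rewrite -addrA lerD2l -[leLHS]addr0 lerD// mulrA -normrM ler_wpM2r//.
have [|y ysc HE] := @mvt_abs _ (fun r : R => F (x + s *: u + r *: e) - r * 'D_e F x)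
    (fun r : R => 'D_e F (x + s *: u + r *: e) - 'D_e F x) (s * c).
  move=> y ysc.
  apply: is_deriveB.
    apply/is_derive_lineP; apply: derivableP; apply: (proj1 (Hdlt _ _)) => /=.
    exact: near_x.
  apply: is_derive_eq.
  by rewrite /GRing.scale/=; ring.
have D : `|'D_e F x - 'D_e F (x + s *: u + y *: e)| <= eps1.
  apply: (proj2 (Hdlt _ _)) => /=.
  exact: near_x.
move: HE; rewrite scale0r addr0 mul0r subr0 => HE.
rewrite addr0 [s *: (1 : R)]mulr1 {2}/H scale0r addr0 mul0r scale0r addr0 subrr subr0.
have -> : H s = s * c * 'D_e F (x + s *: u + y *: e).
  by rewrite /H; move: HE; lra.
rewrite /GRing.scale/= -!mulrA mulKf// -mulrBr normrM.
apply: (@le_trans _ _ (`|c| * eps1)); first by rewrite ler_wpM2l.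
rewrite /eps1 mulrCA ger_pMr// ler_pdivrMr// mul1r; lra.
Unshelve. all: end_near.
Qed.

End DirectionalDerivatives.

(** * First and second derivatives of functions of one variable *)

Section SecondOrderJets.
Variable R : realType.
Implicit Types (u v f : R -> R) (x a b c d : R).

(** A relation carrying the values u' x = a and u'' x = b, so that composite jets are computed by
    composing lemmas; u' is asked for near x, u'' at x only. *)
Definition jet2 x u a b : Prop := exists du : R -> R,
  [/\ \forall t \near x, is_derive (t : R) 1 u (du t), du x = a & is_derive (x : R) 1 du b].

Lemma jet2_eq x u a b a' b' : jet2 x u a b -> a = a' -> b = b' -> jet2 x u a' b'.
Proof. by move=> + <- <-. Qed.

Lemma jet2D x u v a b c d :
  jet2 x u a b -> jet2 x v c d -> jet2 x (fun t => u t + v t) (a + c) (b + d).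
Proof.
move=> [du [u1 <- u2]] [dv [v1 <- v2]]; exists (fun t => du t + dv t); split => //.
  by near=> t; apply: is_deriveD; [near: t|near: t].
exact: is_deriveD.
Unshelve. all: end_near. Qed.

Lemma jet2N x u a b : jet2 x u a b -> jet2 x (fun t => - u t) (- a) (- b).
Proof.
move=> [du [u1 <- u2]]; exists (fun t => - du t); split => //.
  by near=> t; apply: is_deriveN; near: t.
exact: is_deriveN.
Unshelve. all: end_near. Qed.

Lemma jet2M x u v a b c d : jet2 x u a b -> jet2 x v c d ->
  jet2 x (fun t => u t * v t) (a * v x + u x * c) (b * v x + 2 * a * c + u x * d).
Proof.
move=> [du [u1 <- u2]] [dv [v1 <- v2]].
have u0 := nbhs_singleton u1; have v0 := nbhs_singleton v1.
exists (fun t => du t * v t + u t * dv t); split => //.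
  near=> t.
  have ut : is_derive (t : R) 1 u (du t) by near: t.
  have vt : is_derive (t : R) 1 v (dv t) by near: t.
  by apply: is_derive_eq; rewrite /GRing.scale/=; ring.
by apply: is_derive_eq; rewrite /GRing.scale/=; ring.
Unshelve. all: end_near. Qed.

Lemma jet2_comp x f u a b c d : jet2 (u x) f c d -> jet2 x u a b ->
  jet2 x (fun t => f (u t)) (c * a) (d * a ^+ 2 + c * b).
Proof.
move=> [df [f1 <- f2]] [du [u1 <- u2]].
have u0 := nbhs_singleton u1; have f0 := nbhs_singleton f1.
have uc : {for x, continuous u}.
  by apply: differentiable_continuous; apply/derivable1_diffP; exact: (@ex_derive _ _ _ _ _ _ _ u0).
exists (fun t => df (u t) * du t); split => //.
  have fu : \forall t \near x, is_derive (u t) 1 f (df (u t)) by exact: (uc _ f1).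
  near=> t.
  have ut : is_derive (t : R) 1 u (du t) by near: t.
  have ft : is_derive (u t) 1 f (df (u t)) by near: t.
  exact: is_derive1_comp.
have : is_derive (x : R) 1 (df \o u) (d * du x) by exact: is_derive1_comp.
move=> H.
rewrite (_ : (fun t => _) = (df \o u) * du)//.
by apply: is_derive_eq; rewrite /GRing.scale/=; ring.
Unshelve. all: end_near. Qed.

Lemma jet2_derive x u a b : jet2 x u a b -> is_derive (x : R) 1 u a.
Proof. by move=> [du [u1 <- _]]; exact: nbhs_singleton u1. Qed.

Lemma jet2_max x u a b :
  (\forall t \near x, u t <= u x) -> jet2 x u a b -> a = 0 /\ b <= 0.
Proof.
move=> umax uj; have uD := jet2_derive uj; case: uj => du [u1 dua u2].
have : \forall t \near x, u t <= u x /\ is_derive (t : R) 1 u (du t).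
  exact: filterI.
move=> /nbhs_normP[e1 /= e10 He1].
have a0 : a = 0.
  have : is_derive (x : R) 1 u 0.
    apply: (@derive1_at_max _ u (x - e1) (x + e1)).
    - by lra.
    - move=> t; rewrite in_itv/= => /andP[t1 t2].
      apply: (@ex_derive _ _ _ _ _ _ _ (proj2 (He1 t _))) => /=.
      by rewrite distrC ltr_distl t1.
    - by rewrite in_itv/=; apply/andP; split; lra.
    - move=> t; rewrite in_itv/= => /andP[t1 t2].
      by apply: (proj1 (He1 t _)) => /=; rewrite distrC ltr_distl t1.
  by move=> /@derive_val <-; rewrite (@derive_val _ _ _ _ _ _ _ uD).
(* If b > 0, then u' is positive just to the right of x, and u exceeds u x there by the mean value
   theorem. *)
split=> //; rewrite leNgt; apply/negP => b0.
case: (u2) => u2d u2v.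
have du2 : h^-1 *: (du (h *: (1 : R) + x) - du x) @[h --> 0^'] --> b.
  by rewrite -u2v; exact: u2d.
have : \forall h \near (0 : R), h != 0 -> 0 < h^-1 * du (h + x).
  have /cvgr_gt/(_ _ b0) := du2.
  rewrite near_withinE; apply: filterS => h + h0 => /(_ h0).
  by rewrite dua a0 subr0 [h *: (1 : R)]mulr1.
move=> /nbhs_normP[e2 /= e20 He2].
pose s := Num.min e1 e2 / 2.
have s0 : 0 < s by rewrite divr_gt0// lt_min e10.
have s1 : s < e1 by rewrite ltr_pdivrMr// gt_min mulr_natr mulr2n; lra.
have s2 : s < e2 by rewrite ltr_pdivrMr// gt_min mulr_natr mulr2n; lra.
have [|||y] := @MVT _ u du x (x + s); first by lra.
- move=> y; rewrite in_itv/= => /andP[y1 y2].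
  by apply: (proj2 (He1 y _)) => /=; rewrite distrC ltr_distl; lra.
- apply: derivable_within_continuous => y; rewrite in_itv/= => /andP[y1 y2].
  apply: (@ex_derive _ _ _ _ _ _ _ (proj2 (He1 y _))) => /=.
  by rewrite distrC ltr_distl; lra.
rewrite in_itv/= => /andP[y1 y2] E.
have : u (x + s) <= u x.
  by apply: (proj1 (He1 _ _)) => /=; rewrite distrC ltr_distl; lra.
rewrite -subr_le0 E pmulr_lle0; last by lra.
have := He2 (y - x); rewrite /= sub0r normrN ltr_norml subrK subr_eq0 gt_eqF//.
rewrite pmulr_rgt0 ?invr_gt0 ?subr_gt0// => H.
by rewrite leNgt H//; apply/andP; split; lra.
Unshelve. all: end_near. Qed.

End SecondOrderJets.

(** * Euclidean inner product and C^k functions of several variables *)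

Section SmoothFunctions.
Variables (R : realType) (N : nat).
Implicit Types (U : set 'rV[R]_N) (F : 'rV[R]_N -> R) (x u v : 'rV[R]_N).

Lemma dotpC u v : dotp u v = dotp v u.
Proof. by apply: eq_bigr => i _; rewrite mulrC. Qed.

Lemma dotpDr u v x : dotp u (v + x) = dotp u v + dotp u x.
Proof. by rewrite -big_split; apply: eq_bigr => i _; rewrite mxE mulrDr. Qed.

Lemma dotpZr u v (a : R) : dotp u (a *: v) = a * dotp u v.
Proof. by rewrite mulr_sumr; apply: eq_bigr => i _; rewrite mxE mulrCA. Qed.

Lemma dotpNr u v : dotp u (- v) = - dotp u v.
Proof. by rewrite -scaleN1r dotpZr mulN1r. Qed.

Lemma dotpBr u v x : dotp u (v - x) = dotp u v - dotp u x.
Proof. by rewrite dotpDr dotpNr. Qed.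

Lemma dotpDl u v x : dotp (u + v) x = dotp u x + dotp v x.
Proof. by rewrite dotpC dotpDr !(dotpC x). Qed.

Lemma dotpZl u v (a : R) : dotp (a *: u) v = a * dotp u v.
Proof. by rewrite dotpC dotpZr dotpC. Qed.

Lemma dotpNl u v : dotp (- u) v = - dotp u v.
Proof. by rewrite dotpC dotpNr dotpC. Qed.

Lemma dotpBl u v x : dotp (u - v) x = dotp u x - dotp v x.
Proof. by rewrite dotpDl dotpNl. Qed.

Lemma dotp_suml (I : Type) (r : seq I) (f : I -> 'rV[R]_N) x :
  dotp (\sum_(i <- r) f i) x = \sum_(i <- r) dotp (f i) x.
Proof.
elim: r => [|i r IH]; last by rewrite !big_cons dotpDl IH.
by rewrite !big_nil /dotp big1// => i _; rewrite mxE mul0r.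
Qed.

Lemma dotp_ge0 u : 0 <= dotp u u.
Proof. by apply: sumr_ge0 => i _; rewrite -expr2 sqr_ge0. Qed.

Lemma dotp_eq0 u : (dotp u u == 0) = (u == 0).
Proof.
apply/idP/eqP => [|->]; last first.
  by rewrite /dotp big1// => i _; rewrite mxE mul0r.
rewrite psumr_eq0 => [/allP u0|i _]; last by rewrite -expr2 sqr_ge0.
apply/rowP => i; rewrite mxE; apply/eqP.
by have := u0 i (mem_index_enum _); rewrite mulf_eq0 orbb.
Qed.

Lemma enorm_sqr u : enorm u ^+ 2 = dotp u u.
Proof. by rewrite sqr_sqrtr// dotp_ge0. Qed.

Lemma enorm_gt0 u : u != 0 -> 0 < enorm u.
Proof. by move=> u0; rewrite sqrtr_gt0 lt_def dotp_ge0 dotp_eq0 u0. Qed.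

Lemma enormZ (a : R) u : 0 <= a -> enorm (a *: u) = a * enorm u.
Proof.
move=> a0; rewrite /enorm dotpZl dotpZr mulrA -expr2 sqrtrM ?sqr_ge0//.
by rewrite sqrtr_sqr ger0_norm.
Qed.

Lemma dotp_unit_vec u i : dotp u (unit_vec R i) = u 0 i.
Proof.
rewrite /dotp (bigD1 i)//= mxE !eqxx mulr1 big1 ?addr0// => j /negPf ji.
by rewrite mxE ji mulr0.
Qed.

Lemma unit_vec_sum v : v = \sum_i v 0 i *: unit_vec R i.
Proof. by rewrite [LHS]row_sum_delta. Qed.

Lemma class_C_continuous k U F x : class_C k U F -> U x -> {for x, continuous F}.
Proof. by case: k => [|k] [FC _] /FC. Qed.

Lemma class_C_S k U F : class_C k.+1 U F -> class_C k U F.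
Proof.
elim: k F => [|k IH] F [FC FD]; split=> // i; have [F1 F2] := FD i.
by split => //; exact: IH.
Qed.

Lemma class_C_partial k U F i : class_C k.+1 U F -> class_C k U ('D_(unit_vec R i) F).
Proof. by move=> [_ /(_ i)[]]. Qed.

Lemma class_C1_is_derive U F x v : open U -> class_C 1 U F -> U x ->
  is_derive x v F (dotp (gradient F x) v).
Proof.
move=> oU [FC FD] Ux.
rewrite [X in is_derive _ X](unit_vec_sum v) dotpC [X in dotp X](unit_vec_sum v).
rewrite dotp_suml; elim: (index_enum _) => [|i r IH].
  rewrite !big_nil; apply/is_derive_line0.
  rewrite (_ : (fun s : R => _) = cst (F x)); first exact: is_derive_cst.
  by apply/funext => s; rewrite scaler0 addr0.
rewrite !big_cons dotpZl dotpC dotp_unit_vec mxE addrC [X in _ F X]addrC.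
apply: is_derive_addv => //.
  have : \forall z \near x, U z by exact: open_nbhs_nbhs.
  by apply: filterS => z; exact: (proj1 (FD i)).
by have [_ [+ _]] := FD i; exact.
Qed.

(** The second derivative of F at x along v, as the derivative along v of the function dotp
    (gradient F) v. *)
Definition hessian F x v : R :=
  \sum_i v 0 i * dotp (gradient ('D_(unit_vec R i) F) x) v.

Lemma class_C2_jet2 U F x v : open U -> class_C 2 U F -> U x ->
  jet2 0 (fun t => F (x + t *: v)) (dotp (gradient F x) v) (hessian F x v).
Proof.
move=> oU FC Ux.
have lc : {for (0 : R), continuous (fun t : R => x + t *: v)}.
  apply: continuousD; first exact: cst_continuous.
  exact: scalel_continuous.
exists (fun t => dotp (gradient F (x + t *: v)) v); split.
- have : \forall t \near (0 : R), U (x + t *: v).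
    apply: lc; rewrite scale0r addr0; exact: open_nbhs_nbhs.
  apply: filterS => t Ut; apply/is_derive_lineP.
  by apply: class_C1_is_derive Ut => //; exact: class_C_S.
- by rewrite scale0r addr0.
- rewrite (_ : (fun t => _) =
    (\sum_i v 0 i *: (fun t : R => 'D_(unit_vec R i) F (x + t *: v)))); last first.
    apply/funext => t; rewrite fct_sumE; apply: eq_bigr => i _.
    by rewrite mxE mulrC.
  apply: is_derive_sum; last move=> i; apply: is_deriveZ.
  have := is_derive_line0 ('D_(unit_vec R i) F) x v
    (dotp (gradient ('D_(unit_vec R i) F) x) v).
  case=> _; apply; apply: (class_C1_is_derive v oU _ Ux).
  exact: class_C_partial.
Qed.

End SmoothFunctions.

(** * Gradient and Laplacian on the sphere through the homogeneous extension [radial w] *)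

Section SphericalCalculus.
Variables (R : realType) (N : nat).
Implicit Types (w : 'rV[R]_N -> R) (x y z u v : 'rV[R]_N).

Lemma is_derive_row (V : normedModType R) (M : V -> 'rV[R]_N) (x v : V) (d : 'rV[R]_N) :
  (forall i, is_derive x v (fun t => M t 0 i) (d 0 i)) -> is_derive x v M d.
Proof.
move=> Md.
have Mder : derivable M x v.
  by apply/derivable_mxP => i j; rewrite ord1; exact: (@ex_derive _ _ _ _ _ _ _ (Md j)).
split=> //; apply/rowP => j; rewrite derive_mx// mxE.
exact: (@derive_val _ _ _ _ _ _ _ (Md j)).
Qed.

Lemma open_neq0 : open [set x : 'rV[R]_N | x != 0].
Proof.
rewrite openE => x /= x0; apply: (@cvgr_neq0 _ _ _ (nbhs x) _ id x _ x0).
exact: cvg_id.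
Qed.

Lemma sphere_dotp x : sphere x -> dotp x x = 1.
Proof. by move=> xs; rewrite -enorm_sqr xs expr1n. Qed.

Lemma dotp_sphere x : dotp x x = 1 -> sphere x.
Proof. by move=> xx; rewrite /sphere/= /enorm xx sqrtr1. Qed.

Lemma sphere_neq0 x : sphere x -> x != 0.
Proof. by move=> /sphere_dotp xx; rewrite -dotp_eq0 xx oner_eq0. Qed.

Lemma radial_sphere (T : Type) (f : 'rV[R]_N -> T) x : sphere x -> radial f x = f x.
Proof. by move=> xs; rewrite /radial xs invr1 scale1r. Qed.

Lemma sphere_normalize z : z != 0 -> sphere ((enorm z)^-1 *: z).
Proof.
move=> /enorm_gt0 z0.
by rewrite /sphere/= enormZ ?invr_ge0 ?ltW// mulVf// gt_eqF.
Qed.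

Lemma radialZ (T : Type) (f : 'rV[R]_N -> T) (a : R) z :
  0 < a -> radial f (a *: z) = radial f z.
Proof.
move=> a0; rewrite /radial enormZ ?ltW// scalerA invfM -mulrA mulrCA.
by rewrite mulVf ?mulr1// gt_eqF.
Qed.

(** The gradient of a function homogeneous of degree 0 is homogeneous of degree -1. *)
Lemma gradient_radialZ w (a : R) z : class_C 1 [set x | x != 0] (radial w) ->
  0 < a -> z != 0 -> gradient (radial w) (a *: z) = a^-1 *: gradient (radial w) z.
Proof.
move=> wC a0 z0; apply/rowP => i; rewrite !mxE.
suff H : is_derive (a *: z) (unit_vec R i) (radial w)
    (a^-1 * 'D_(unit_vec R i) (radial w) z) by exact: (@derive_val _ _ _ _ _ _ _ H).
apply/is_derive_line0.
rewrite (_ : (fun s => _) =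
    (fun s : R => radial w (z + s *: (a^-1 *: unit_vec R i)))); last first.
  apply/funext => s; rewrite -(radialZ _ (z + _) a0) scalerDr !scalerA.
  by rewrite mulrAC mulfV ?mul1r// gt_eqF.
apply/is_derive_line0; apply: is_derive_scalev; apply: derivableP.
by have [_ /(_ i)[+ _]] := wC; apply.
Qed.

(** [radial w] is constant along the ray through z; its gradient is therefore already tangent. *)
Lemma dotp_gradient_radial w z : class_C 1 [set x | x != 0] (radial w) ->
  z != 0 -> dotp (gradient (radial w) z) z = 0.
Proof.
move=> wC z0.
have /is_derive_line0/@derive_val <- := class_C1_is_derive z open_neq0 wC z0.
rewrite (@near_eq_derive _ _ _ _ (cst (radial w z))) ?derive_cst ?oner_eq0//.
near=> s.
rewrite -[X in X + _]scale1r -scalerDl radialZ//.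
by rewrite addrC -ltrBlDr sub0r; near: s; apply: lt_nbhsr; lra.
Unshelve. all: end_near. Qed.

Lemma sphere_grad_gradient w x : class_C 1 [set x | x != 0] (radial w) ->
  sphere x -> sphere_grad w x = gradient (radial w) x.
Proof.
move=> wC xs; rewrite /sphere_grad /tproj dotp_gradient_radial ?sphere_neq0//.
by rewrite scale0r subr0.
Qed.

Lemma radial_sphere_grad w z : class_C 1 [set x | x != 0] (radial w) ->
  z != 0 -> radial (sphere_grad w) z = enorm z *: gradient (radial w) z.
Proof.
move=> wC z0; have e0 := enorm_gt0 z0.
rewrite /radial sphere_grad_gradient//; last exact: sphere_normalize.
by rewrite gradient_radialZ ?invr_gt0// invrK.
Qed.

Lemma is_derive_enorm x v : sphere x -> dotp x v = 0 -> is_derive x v (@enorm R N) 0.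
Proof.
move=> xs xv; apply/is_derive_line0.
have E (s : R) : dotp (x + s *: v) (x + s *: v) = 1 + s ^+ 2 * dotp v v.
  rewrite dotpDl !dotpDr !dotpZl !dotpZr sphere_dotp// (dotpC v x) xv; ring.
rewrite (_ : (fun s => _) = Num.sqrt \o (fun s : R => 1 + s ^+ 2 * dotp v v)); last first.
  by apply/funext => s /=; rewrite -E.
rewrite -[X in is_derive _ _ _ X](mulr0 ((2 * Num.sqrt (1 + 0 ^+ 2 * dotp v v))^-1)).
apply: is_derive1_comp.
  by apply: is_derive1_sqrt; rewrite expr0n/= mul0r addr0.
apply: is_derive_eq; rewrite /GRing.scale/=; ring.
Qed.

(** The extended field is z |-> |z| gradient (radial w) z; the factor |z| is 1 at x and stationary
    in tangent directions, so only second derivatives of [radial w] remain. *)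
Lemma is_derive_radial_sphere_grad w x v : class_C 2 [set x | x != 0] (radial w) ->
  sphere x -> dotp x v = 0 ->
  is_derive x v (radial (sphere_grad w))
    (\row_i dotp (gradient ('D_(unit_vec R i) (radial w)) x) v).
Proof.
move=> wC xs xv; have wC1 := class_C_S wC; have x0 := sphere_neq0 xs.
apply: is_derive_row => i; rewrite mxE.
have H : is_derive x v (fun z => enorm z * 'D_(unit_vec R i) (radial w) z)
    (dotp (gradient ('D_(unit_vec R i) (radial w)) x) v).
  have := is_derive_enorm xs xv.
  have := class_C1_is_derive v open_neq0 (class_C_partial i wC) x0.
  move=> ? ?; apply: is_derive_eq.
  by rewrite xs /GRing.scale/= mulr0 addr0 mul1r.
apply: near_eq_is_derive H.
have : \forall z \near x, z != 0 by exact: open_nbhs_nbhs (conj open_neq0 _).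
by apply: filterS => z z0; rewrite radial_sphere_grad// !mxE.
Qed.

Lemma dotp_tproj x u v : dotp x v = 0 -> dotp (tproj x u) v = dotp u v.
Proof. by move=> xv; rewrite dotpBl dotpZl xv mulr0 subr0. Qed.

Lemma dotp_sphere_tproj x u : sphere x -> dotp x (tproj x u) = 0.
Proof.
by move=> xs; rewrite dotpBr dotpZr sphere_dotp// mulr1 dotpC subrr.
Qed.

(** The directions are tangent, so pairing with them removes the projection in [sphere_conn]. *)
Lemma laplace_beltrami_hessian w x : sphere_C 2 w -> sphere x ->
  laplace_beltrami w x = \sum_i hessian (radial w) x (tproj x (unit_vec R i)).
Proof.
move=> wC xs; apply: eq_bigr => i _.
set v := tproj x _; have xv : dotp x v = 0 by exact: dotp_sphere_tproj.
rewrite /sphere_conn dotp_tproj//.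
rewrite (@derive_val _ _ _ _ _ _ _ (is_derive_radial_sphere_grad wC xs xv)).
by rewrite /hessian /dotp; apply: eq_bigr => j _; rewrite mxE mulrC.
Qed.

End SphericalCalculus.

(** * First and second order conditions at a two-point maximum *)

Section TwoPointMaximum.
Variables (R : realType) (N : nat).
Implicit Types (w : 'rV[R]_N -> R) (x y d u v a b : 'rV[R]_N).

(* Satisfied by every orthonormal basis of the tangent space at [x], and also by
   the [N] projections of the canonical basis. *)
Definition tangent_frame x (f : 'I_N -> 'rV[R]_N) : Prop :=
  forall a b, \sum_i dotp (f i) a * dotp (f i) b = dotp a b - dotp x a * dotp x b.

Lemma tangent_frame_tproj x : sphere x ->
  tangent_frame x (fun i => tproj x (unit_vec R i)).
Proof.
move=> /sphere_dotp xx a b.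
under eq_bigr => i _.
  rewrite !dotpBl !dotpZl (dotpC _ a) (dotpC _ b) (dotpC _ x) !dotp_unit_vec.
  rewrite (_ : _ * _ = a 0 i * b 0 i - (x 0 i * a 0 i) * dotp x b
    - (x 0 i * b 0 i) * dotp x a + (x 0 i * x 0 i) * (dotp x a * dotp x b)); last ring.
  over.
rewrite big_split/= !sumrB -!mulr_suml -/(dotp a b) -/(dotp x a) -/(dotp x b).
by rewrite -/(dotp x x) xx; ring.
Qed.

(** The frame identity alone determines the trace, so the frame at y may be the reflected image of
    the one at x. *)
Lemma hessian_frame (F : 'rV[R]_N -> R) x f g :
  tangent_frame x f -> tangent_frame x g ->
  \sum_i hessian F x (f i) = \sum_i hessian F x (g i).
Proof.
have E e : tangent_frame x e -> \sum_i hessian F x (e i) =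
    \sum_j dotp (unit_vec R j) (gradient ('D_(unit_vec R j) F) x)
      - \sum_j dotp x (unit_vec R j) * dotp x (gradient ('D_(unit_vec R j) F) x).
  move=> fe; rewrite exchange_big/= -sumrB; apply: eq_bigr => j _; rewrite -fe.
  by apply: eq_bigr => i _; rewrite dotp_unit_vec dotpC.
by move=> /E -> /E ->.
Qed.

Lemma tangent_frame_norm x f : sphere x -> tangent_frame x f ->
  \sum_i dotp (f i) (f i) = N%:R - 1.
Proof.
move=> /sphere_dotp xx ff; rewrite exchange_big/=.
transitivity (\sum_(j < N) (1 - x 0 j * x 0 j)).
  apply: eq_bigr => j _; have := ff (unit_vec R j) (unit_vec R j).
  rewrite !dotp_unit_vec mxE !eqxx /= => <-.
  by apply: eq_bigr => i _; rewrite dotp_unit_vec.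
by rewrite sumrB -/(dotp x x) xx sumr_const card_ord.
Qed.

Definition reflection d v : 'rV[R]_N := v - (2 * dotp v d / dotp d d) *: d.

Lemma reflection_sym d u v : dotp (reflection d u) v = dotp u (reflection d v).
Proof. by rewrite /reflection dotpBl dotpBr dotpZl dotpZr (dotpC d v); ring. Qed.

Lemma dotp_reflection d u v : d != 0 ->
  dotp (reflection d u) (reflection d v) = dotp u v.
Proof.
rewrite -dotp_eq0 => d0.
rewrite /reflection !dotpBl !dotpBr !dotpZl !dotpZr (dotpC d v).
by field.
Qed.

Lemma tangent_frame_reflection x y d f : d != 0 -> reflection d x = y ->
  tangent_frame x f -> tangent_frame y (fun i => reflection d (f i)).
Proof.
move=> d0 xy fx a b; under eq_bigr do rewrite !reflection_sym.
by rewrite fx dotp_reflection// -!reflection_sym xy.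
Qed.

Lemma dotp_sphereB x y : sphere x -> sphere y -> dotp (y - x) (y - x) = 2 * (1 - dotp x y).
Proof.
by move=> /sphere_dotp xx /sphere_dotp yy; rewrite dotpBl !dotpBr (dotpC y x) xx yy; ring.
Qed.

Lemma dotp_lt1 x y : sphere x -> sphere y -> x != y -> 0 < 1 - dotp x y.
Proof.
move=> xs ys xy; rewrite -(pmulr_rgt0 _ (ltr0n _ 2)) -dotp_sphereB// lt_def dotp_ge0.
by rewrite dotp_eq0 subr_eq0 eq_sym xy.
Qed.

Lemma reflection_sphere x y : sphere x -> sphere y -> x != y ->
  reflection (y - x) x = y.
Proof.
move=> xs ys xy; have h0 := dotp_lt1 xs ys xy.
rewrite /reflection dotp_sphereB// dotpBr (sphere_dotp xs).
rewrite (_ : 2 * _ / _ = -1); last by field; rewrite gt_eqF.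
by rewrite scaleN1r opprK subrKC.
Qed.

Lemma jet2_near (t : R) (u : R -> R) (a b : R) (C : set R) :
  jet2 t u a b -> nbhs (u t) C -> \forall s \near t, C (u s).
Proof.
move=> /jet2_derive ud uC.
have uc : {for t, continuous u}.
  by apply: differentiable_continuous; apply/derivable1_diffP; exact: (@ex_derive _ _ _ _ _ _ _ ud).
exact: uc.
Qed.

Lemma jet2_quadratic (a b c : R) : jet2 0 (fun t => a + b * t + c * t ^+ 2) b (2 * c).
Proof.
exists (fun t => b + 2 * c * t); split.
- near=> t; apply: is_derive_eq; rewrite /GRing.scale/=; ring.
- by rewrite mulr0 addr0.
- by apply: is_derive_eq; rewrite /GRing.scale/=; ring.
Unshelve. all: end_near. Qed.

Lemma jet2_inv1 : jet2 1 (@GRing.inv R) (-1) 2.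
Proof.
exists (fun t => - t ^- 2); split.
- have : \forall t \near (1 : R), t != 0.
    by apply: (@cvgr_neq0 _ _ _ (nbhs (1 : R)) _ id 1 _ (oner_neq0 R)); exact: cvg_id.
  apply: filterS => t t0; have := is_deriveV t0 (is_derive_id t (1 : R)).
  move=> H; apply: (is_derive_eq H).
  by rewrite /GRing.scale/= mulr1.
- by rewrite expr1n invr1.
- have H1 : is_derive (1 : R) 1 (fun t : R => t ^+ 2) 2.
    by apply: is_derive_eq; rewrite /GRing.scale/=; ring.
  have N1 : (1 : R) ^+ 2 != 0 by rewrite expr1n oner_neq0.
  have H := @is_deriveV _ (fun t : R => t ^+ 2) 1 _ _ N1 H1.
  by apply: is_derive_eq; rewrite /GRing.scale/= !expr1n invr1; ring.
Qed.

(** This is 1 minus the inner product of the normalised points x + t v and y + t v', with c = dotp x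
    y, q = dotp v v' and e the common squared length of v and v', which makes the product of the two
    norms equal to 1 + e t^2. *)
Lemma jet2_distance (c p q e : R) :
  jet2 0 (fun t => 1 - (c + p * t + q * t ^+ 2) * (1 + e * t ^+ 2)^-1)
    (- p) (- (2 * q) + 2 * c * e).
Proof.
have j1 := jet2_quadratic c p q.
have j2 : jet2 0 (fun t => (1 + 0 * t + e * t ^+ 2)^-1) 0 (- (2 * e)).
  have := @jet2_comp _ 0 (@GRing.inv R) (fun t => 1 + 0 * t + e * t ^+ 2) 0 (2 * e) (-1) 2.
  rewrite expr0n/= !mulr0 !addr0 => H.
  apply: (jet2_eq (H jet2_inv1 _)); [|ring|ring].
  by have := jet2_quadratic 1 0 e.
have := jet2D (jet2_quadratic 1 0 0) (jet2N (jet2M j1 j2)).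
rewrite (_ : (fun t => _) = (fun t => 1 - (c + p * t + q * t ^+ 2) * (1 + e * t ^+ 2)^-1)).
  by move=> H; apply: (jet2_eq H); rewrite expr0n/= !mulr0 !addr0 ?invr1; ring.
by apply/funext => t; rewrite !mul0r !addr0.
Qed.

Lemma dotp_sphere_line x v (t : R) : sphere x -> dotp x v = 0 ->
  dotp (x + t *: v) (x + t *: v) = 1 + dotp v v * t ^+ 2.
Proof.
move=> xs xv; rewrite dotpDl !dotpDr !dotpZl !dotpZr sphere_dotp// (dotpC v x) xv.
ring.
Qed.

Lemma sphere_line_neq0 x v (t : R) : sphere x -> dotp x v = 0 -> x + t *: v != 0.
Proof.
move=> xs xv; rewrite -dotp_eq0 dotp_sphere_line// gt_eqF//.
by rewrite ltr_pwDl// mulr_ge0 ?dotp_ge0 ?sqr_ge0.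
Qed.

Section MaximumPair.
Variables (w : 'rV[R]_N -> R) (x y : 'rV[R]_N) (A B : set R).
Variables (f1 f2 G : R -> R) (a1 b1 a2 b2 g1 g2 : R).
Let n : R := N%:R - 1.
Let h : R := 1 - dotp x y.

(** [A] and [B] restrict the competitors to values where [f1] and [f2] are meaningful: the whole
    line for differences, a half-line each for logarithms. *)
Definition pair_maximum : Prop := forall x' y', sphere x' -> sphere y' ->
  A (w y') -> B (w x') ->
  f1 (w y') + f2 (w x') - G (1 - dotp x' y') <= f1 (w y) + f2 (w x) - G h.

(** Moving along x + t v and y + t v' gives a function of t with a local maximum at 0; [radial]
    takes care of the normalisation in w. *)
Lemma pair_maximum_jet v v' : sphere_C 2 w -> sphere x -> sphere y ->
  nbhs (w y) A -> nbhs (w x) B -> pair_maximum ->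
  jet2 (w y) f1 a1 b1 -> jet2 (w x) f2 a2 b2 -> jet2 h G g1 g2 ->
  dotp x v = 0 -> dotp y v' = 0 -> dotp v v = dotp v' v' ->
  let F := radial w in let p := dotp v y + dotp x v' in
  a1 * dotp (gradient F y) v' + a2 * dotp (gradient F x) v + g1 * p = 0 /\
  b1 * dotp (gradient F y) v' ^+ 2 + a1 * hessian F y v' +
  (b2 * dotp (gradient F x) v ^+ 2 + a2 * hessian F x v) -
  (g2 * p ^+ 2 + g1 * (2 * (1 - h) * dotp v v - 2 * dotp v v')) <= 0.
Proof.
move=> wC xs ys Ay Bx wmax jf1 jf2 jG xv yv vv F p.
have Fx := radial_sphere w xs; have Fy := radial_sphere w ys.
have jx := class_C2_jet2 v (@open_neq0 R N) wC (sphere_neq0 xs).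
have jy := class_C2_jet2 v' (@open_neq0 R N) wC (sphere_neq0 ys).
have jH := jet2_distance (1 - h) p (dotp v v') (dotp v v).
have j1 := @jet2_comp _ 0 f1 _ _ _ a1 b1 _ jy.
have j2 := @jet2_comp _ 0 f2 _ _ _ a2 b2 _ jx.
have j3 := @jet2_comp _ 0 G _ _ _ g1 g2 _ jH.
move: j1 j2 j3.
rewrite !scale0r !addr0 Fx Fy expr0n/= !mulr0 !addr0 invr1 mulr1 subKr.
move=> /(_ jf1) j1 /(_ jf2) j2 /(_ jG) j3.
have j := jet2D (jet2D j1 j2) (jet2N j3).
have [|E1 E2] := jet2_max _ j; last first.
  split; first by rewrite -E1; ring.
  by apply: le_trans E2; rewrite le_eqVlt; apply/orP; left; apply/eqP; ring.
rewrite !scale0r !addr0 Fx Fy expr0n/= !mulr0 !addr0 invr1 mulr1 subKr.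
have NA : \forall t \near (0 : R), A (F (y + t *: v')).
  by apply: (jet2_near jy); rewrite scale0r addr0 Fy.
have NB : \forall t \near (0 : R), B (F (x + t *: v)).
  by apply: (jet2_near jx); rewrite scale0r addr0 Fx.
near=> t.
have x't := sphere_line_neq0 t xs xv; have y't := sphere_line_neq0 t ys yv.
have := wmax _ _ (sphere_normalize x't) (sphere_normalize y't).
have -> : w ((enorm (y + t *: v'))^-1 *: (y + t *: v')) = F (y + t *: v') by [].
have -> : w ((enorm (x + t *: v))^-1 *: (x + t *: v)) = F (x + t *: v) by [].
rewrite dotpZl dotpZr {1}/enorm {1}/enorm !dotp_sphere_line// -vv mulrA -invfM -expr2.
rewrite sqr_sqrtr; last exact: addr_ge0 (mulr_ge0 (dotp_ge0 _) (sqr_ge0 _)).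
rewrite [X in _ -> _ -> _ - G (1 - X) <= _]mulrC.
rewrite (_ : dotp (x + t *: v) (y + t *: v') = 1 - h + p * t + dotp v v' * t ^+ 2).
  by rewrite /h subKr; apply; near: t.
rewrite /h /p !dotpDl !dotpDr !dotpZl !dotpZr; ring.
Unshelve. all: end_near. Qed.

(* The two points are moved along [e i] and along its image under the reflection
   exchanging them. The pair of directions [(e i, - reflection (e i))], along
   which the distance is stationary, only serves to get [J']. *)
Theorem pair_maximum_principle : sphere_C 2 w -> sphere x -> sphere y -> x != y ->
  nbhs (w y) A -> nbhs (w x) B -> pair_maximum ->
  jet2 (w y) f1 a1 b1 -> jet2 (w x) f2 a2 b2 -> jet2 h G g1 g2 ->
  [/\ (a1 * enorm (sphere_grad w y)) ^+ 2 = g1 ^+ 2 * (h * (2 - h)),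
      (a2 * enorm (sphere_grad w x)) ^+ 2 = g1 ^+ 2 * (h * (2 - h)) &
      a1 * laplace_beltrami w y + b1 * enorm (sphere_grad w y) ^+ 2 +
      (a2 * laplace_beltrami w x + b2 * enorm (sphere_grad w x) ^+ 2) <=
      4 * g2 * (h * (2 - h)) + 2 * g1 * (2 - h - n * h)].
Proof.
move=> wC xs ys xy Ay Bx wmax jf1 jf2 jG.
have wC1 : class_C 1 [set x | x != 0] (radial w) by exact: (@class_C_S _ _ 1 _ _ wC).
pose d := y - x; pose e i := tproj x (unit_vec R i).
have d0 : d != 0 by rewrite subr_eq0 eq_sym.
have Rx : reflection d x = y by exact: reflection_sphere.
have fx : tangent_frame x e by exact: tangent_frame_tproj.
have fy := tangent_frame_reflection d0 Rx fx.
have xe i : dotp x (e i) = 0 by exact: dotp_sphere_tproj.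
have ye i : dotp y (reflection d (e i)) = 0 by rewrite -Rx dotp_reflection.
have J i := pair_maximum_jet wC xs ys Ay Bx wmax jf1 jf2 jG (xe i) (ye i)
  (esym (dotp_reflection _ _ d0)).
have J' i : a2 * dotp (gradient (radial w) x) (e i)
    = a1 * dotp (gradient (radial w) y) (reflection d (e i)).
  have yN : dotp y (- reflection d (e i)) = 0 by rewrite dotpNr ye oppr0.
  have NN : dotp (e i) (e i) = dotp (- reflection d (e i)) (- reflection d (e i)).
    by rewrite dotpNl dotpNr opprK dotp_reflection.
  have [+ _] := pair_maximum_jet wC xs ys Ay Bx wmax jf1 jf2 jG (xe i) yN NN.
  rewrite !dotpNr -[dotp x _]reflection_sym Rx (dotpC y) subrr mulr0 addr0 => H.
  by apply/eqP; rewrite -subr_eq0 -H; apply/eqP; ring.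
(* Both pairings in p equal dotp (e i) y and, by [J'], both gradient terms agree, so the first order
   condition can be halved. *)
have J1 i : a2 * dotp (gradient (radial w) x) (e i) = - g1 * dotp (e i) y.
  have [/= + _] := J i.
  rewrite -J' -[dotp x _]reflection_sym Rx dotpC (dotpC y) => H.
  lra.
have c1 : \sum_i dotp (e i) y ^+ 2 = h * (2 - h).
  under eq_bigr do rewrite expr2.
  by rewrite fx (sphere_dotp ys) /h; ring.
have gx : \sum_i dotp (gradient (radial w) x) (e i) ^+ 2 = enorm (sphere_grad w x) ^+ 2.
  rewrite enorm_sqr sphere_grad_gradient//.
  under eq_bigr do rewrite dotpC expr2.
  by rewrite fx dotpC dotp_gradient_radial ?mul0r ?subr0// sphere_neq0.
have gy : \sum_i dotp (gradient (radial w) y) (reflection d (e i)) ^+ 2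
    = enorm (sphere_grad w y) ^+ 2.
  rewrite enorm_sqr sphere_grad_gradient//.
  under eq_bigr do rewrite dotpC expr2.
  by rewrite fy dotpC dotp_gradient_radial ?mul0r ?subr0// sphere_neq0.
split.
- rewrite exprMn -gy mulr_sumr -c1 mulr_sumr; apply: eq_bigr => i _.
  by rewrite -exprMn -J' J1 exprMn sqrrN.
- rewrite exprMn -gx mulr_sumr -c1 mulr_sumr; apply: eq_bigr => i _.
  by rewrite -exprMn J1 exprMn sqrrN.
have n1 : \sum_i dotp (e i) (e i) = n := tangent_frame_norm xs fx.
have h0 : 0 < h by exact: dotp_lt1.
have aux (a k s : R) : 0 < k -> a - 2 * s / (2 * k) * s = a - k^-1 * (s * s).
  by move=> k0; field; rewrite gt_eqF.
have dd : dotp d d = 2 * h by exact: dotp_sphereB.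
(* The trace of the reflection over the frame: each term is |e i|^2 - (dotp (e i) d)^2 / h, and the
   tangential part of d at x has squared length 2 h - h^2. *)
have n2 : \sum_i dotp (e i) (reflection d (e i)) = n - 2 + h.
  have : \sum_i dotp (e i) d * dotp (e i) d = 2 * h - h ^+ 2.
    by rewrite fx dd dotpBr sphere_dotp// /h; ring.
  rewrite -n1 => E.
  rewrite (_ : _ - 2 + h = \sum_i dotp (e i) (e i) - h^-1 * (2 * h - h ^+ 2)).
    2: by field; rewrite gt_eqF.
  rewrite -E mulr_sumr -sumrB; apply: eq_bigr => i _.
  by rewrite dotpBr dotpZr dd aux.
have S : \sum_i (b1 * dotp (gradient (radial w) y) (reflection d (e i)) ^+ 2 +
    a1 * hessian (radial w) y (reflection d (e i)) +
    (b2 * dotp (gradient (radial w) x) (e i) ^+ 2 + a2 * hessian (radial w) x (e i)) -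
    (4 * g2 * dotp (e i) y ^+ 2 +
     g1 * (2 * (1 - h) * dotp (e i) (e i) - 2 * dotp (e i) (reflection d (e i))))) <= 0.
  apply: sumr_le0 => i _; have [_ /= H] := J i; apply: le_trans H.
  rewrite -[dotp x _]reflection_sym Rx (dotpC y) le_eqVlt. apply/orP; left; apply/eqP; ring.
move: S; rewrite sumrB !big_split/= -!mulr_sumr sumrB -!mulr_sumr.
rewrite c1 gx gy n1 n2 (hessian_frame _ fy (tangent_frame_tproj ys)).
rewrite -!laplace_beltrami_hessian// subr_le0 => S.
apply: (le_trans _ (le_trans S _)); rewrite le_eqVlt; apply/orP; left; apply/eqP; ring.
Qed.

End MaximumPair.
End TwoPointMaximum.

(** * Lipschitz bound on the sphere *)

Section PairMaximizers.
Variables (R : realType) (N : nat).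
Implicit Types (w : 'rV[R]_N -> R) (x y u v : 'rV[R]_N).

Lemma dotp_cauchy_schwarz u v : dotp u v ^+ 2 <= dotp u u * dotp v v.
Proof.
have [->|v0] := eqVneq v 0.
  by rewrite -(scale0r 0) !dotpZr !mul0r mulr0 expr0n.
have : 0 < dotp v v by rewrite lt_def dotp_eq0 v0 dotp_ge0.
have := dotp_ge0 (dotp v v *: u - dotp u v *: v).
rewrite dotpBl !dotpBr !dotpZl !dotpZr (dotpC v u) => + vv.
have -> : forall s t r : R, t * (t * r) - t * (s * s) - (s * (t * s) - s * (s * t))
  = t * (r * t - s ^+ 2) by move=> s t r; ring.
by rewrite pmulr_rge0// subr_ge0.
Qed.

Lemma dotp_sphere_bound x y : sphere x -> sphere y -> 0 <= 1 - dotp x y <= 2.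
Proof.
move=> xs ys.
have := dotp_ge0 (y - x); rewrite dotp_sphereB// pmulr_rge0// => -> /=.
have := dotp_ge0 (x + y); rewrite dotpDl !dotpDr (dotpC y) !sphere_dotp//; lra.
Qed.

(** Mean value theorem along the chord: for h <= 1 it stays at squared distance at least 1/2 from
    the origin, so by homogeneity the squared gradient is at most 2 M on it, and its squared length
    is 2 h. *)
Lemma sphere_lipschitz w (M : R) x y : sphere_C 1 w ->
  (forall z, sphere z -> dotp (gradient (radial w) z) (gradient (radial w) z) <= M) ->
  sphere x -> sphere y -> 1 - dotp x y <= 1 ->
  (w y - w x) ^+ 2 <= 4 * M * (1 - dotp x y).
Proof.
move=> wC gM xs ys h1; set F := radial w in gM.
set h := 1 - dotp x y in h1 *.
have h0 : 0 <= h by have /andP[] := dotp_sphere_bound xs ys.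
pose d := y - x.
have dd : dotp d d = 2 * h by exact: dotp_sphereB.
have zz (t : R) : 0 <= t <= 1 -> 1 / 2 <= dotp (x + t *: d) (x + t *: d).
  move=> /andP[t0 t1]; rewrite dotpDl !dotpDr !dotpZl !dotpZr dd (dotpC d x).
  rewrite dotpBr sphere_dotp// (_ : dotp x y - 1 = - h); last by rewrite /h; ring.
  have : 0 <= (2 * t - 1) ^+ 2 * h by rewrite mulr_ge0 ?sqr_ge0.
  lra.
have z0 (t : R) : 0 <= t <= 1 -> x + t *: d != 0.
  by move=> /zz; rewrite -dotp_eq0; apply: contraTneq => ->; lra.
have Fd (t : R) : 0 <= t <= 1 -> is_derive t 1 (fun s : R => F (x + s *: d))
    (dotp (gradient F (x + t *: d)) d).
  move=> t01; rewrite is_derive_lineP.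
  by apply: class_C1_is_derive wC (z0 _ t01); exact: open_neq0.
have in01 (t : R) : t \in `[0, 1]%R -> 0 <= t <= 1 by rewrite in_itv.
have [t t01||t t01] := @MVT_segment _ (fun s : R => F (x + s *: d))
  (fun t => dotp (gradient F (x + t *: d)) d) _ _ ler01.
- apply: Fd; move: t01; rewrite !in_itv/= => /andP[? ?].
  by apply/andP; split; exact: ltW.
- apply: derivable_within_continuous => t /in01 t01.
  exact: (@ex_derive _ _ _ _ _ _ _ (Fd t t01)).
move/in01 : t01 => t01; rewrite scale1r scale0r addr0 subrKC subr0 mulr1 /F !radial_sphere// => ->.
have /enorm_gt0 := z0 t t01; have := zz t t01.
have := sphere_normalize (z0 t t01).
set z := x + t *: d => zs zz2 ez.
have -> : gradient F z = (enorm z)^-1 *: gradient F ((enorm z)^-1 *: z).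
  rewrite -gradient_radialZ ?sphere_neq0//.
  by rewrite scalerA mulfV ?scale1r// gt_eqF.
apply: le_trans (dotp_cauchy_schwarz _ _) _.
rewrite dd dotpZl dotpZr mulrA -invfM -expr2 enorm_sqr.
have gz := gM _ zs; have gz0 := dotp_ge0 (gradient F ((enorm z)^-1 *: z)).
set g := dotp _ (gradient F _) in gz gz0 *.
have zp : 0 < dotp z z by apply: lt_le_trans zz2; rewrite divr_gt0.
have : (dotp z z)^-1 * g <= 2 * M.
  rewrite mulrC ler_pdivrMr//; nra.
nra.
Qed.

End PairMaximizers.

(** * Compactness and existence of maximal pairs *)

Section PairMaximizerExistence.
Variables (R : realType) (N : nat).
Implicit Types (w : 'rV[R]_N -> R) (x y u v : 'rV[R]_N).

Lemma dotp_continuous : continuous (fun z : 'rV[R]_N * 'rV[R]_N => dotp z.1 z.2).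
Proof.
move=> z; rewrite /dotp.
apply: (@cvg_big _ _ +%R 0) => //=; last first.
  move=> i _; apply: cvgM.
    apply: (@cvg_comp _ _ _ fst (fun u : 'rV[R]_N => u 0 i) _ (nbhs z.1)).
      exact: cvg_fst.
    exact: coord_continuous.
  apply: (@cvg_comp _ _ _ snd (fun u : 'rV[R]_N => u 0 i) _ (nbhs z.2)).
    exact: cvg_snd.
  exact: coord_continuous.
exact: add_continuous.
Qed.

Lemma dotp_sqr_continuous : continuous (fun z : 'rV[R]_N => dotp z z).
Proof.
apply: (@continuous_big _ _ +%R 0); first exact: add_continuous.
move=> i _ z; apply: continuousM.
  exact: coord_continuous.
exact: coord_continuous.
Qed.

Lemma compact_sphere : compact (@sphere R N).
Proof.
have -> : @sphere R N = (fun z => dotp z z) @^-1` [set 1].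
  by apply/seteqP; split=> z /=; [exact: sphere_dotp|exact: dotp_sphere].
apply: bounded_closed_compact; last first.
  apply: preimage_closed; last exact: closed_eq.
  by move=> z _; exact: dotp_sqr_continuous.
exists 1; split => // M M1 z /= zz.
apply: le_trans (ltW M1); rewrite /Num.norm/= mx_normrE.
apply: bigmax_le => // -[i j] _ /=; rewrite ord1.
rewrite -(@ler_pXn2r _ 2)// ?nnegrE// expr1n real_normK ?num_real// -zz.
rewrite /dotp (bigD1 j)//= -expr2 lerDl; apply: sumr_ge0 => k _.
by rewrite -expr2 sqr_ge0.
Qed.

(* Near the diagonal the Lipschitz bound on [w] outweighs the singularity of [D],
   so that the supremum is a maximum over a compact set away from the diagonal. *)
Lemma pair_maximizer w (U : R -> R -> R) (D : R -> R) (M C b : R) (m : nat) x0 y0 :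
  sphere_C 1 w ->
  (forall z, sphere z -> dotp (gradient (radial w) z) (gradient (radial w) z) <= M) ->
  continuous (fun z : R * R => U z.1 z.2) ->
  (forall s t, U s t ^+ 2 <= ((s - t) ^+ 2) ^+ m) ->
  (forall h, 0 < h -> {for h, continuous D}) ->
  (forall h, 0 < h <= 2 -> 0 <= D h <= C * h `^ (- b)) -> 2 * b < m%:R -> (0 < m)%N ->
  sphere x0 -> sphere y0 -> x0 != y0 ->
  0 < U (w y0) (w x0) * D (1 - dotp x0 y0) ->
  exists x y, [/\ sphere x, sphere y, x != y &
    forall x' y', sphere x' -> sphere y' ->
      U (w y') (w x') * D (1 - dotp x' y') <= U (w y) (w x) * D (1 - dotp x y)].
Proof.
move=> wC gM Uc Ub Dc Db bm m0 x0s y0s xy0.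
set P := fun x y => U (w y) (w x) * D (1 - dotp x y) => P0.
have M0 : 0 <= M by apply: le_trans (gM _ x0s); exact: dotp_ge0.
have D0 (h : R) : 0 < h <= 2 -> 0 <= D h by move=> /Db/andP[].
have C0 : 0 <= C.
  have /Db/andP[d1 d2] : 0 < (1 : R) <= 2 by apply/andP; split; lra.
  by move: d2; rewrite powR1 mulr1; exact: le_trans.
have small x y : sphere x -> sphere y -> x != y -> 1 - dotp x y <= 1 ->
    P x y ^+ 2 <= (4 * M) ^+ m * C ^+ 2 * (1 - dotp x y) `^ (m%:R - 2 * b).
  move=> xs ys xy h1; have h0 := dotp_lt1 xs ys xy.
  have L := sphere_lipschitz wC gM xs ys h1.
  rewrite /P; set h := 1 - _ in h0 h1 L *.
  have /Db/andP[d1 d2] : 0 < h <= 2 by rewrite h0/=; lra.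
  rewrite exprMn (_ : _ `^ (m%:R - 2 * b) = h ^+ m * (h `^ (- b)) ^+ 2); last first.
    rewrite powRD; last by rewrite (gt_eqF h0) implybT.
    rewrite powR_mulrn ?(ltW h0)//.
    by rewrite -[in RHS]powR_mulrn ?powR_ge0// -powRrM mulNr (mulrC b).
  rewrite [leRHS]mulrACA -[X in _ <= X * _]exprMn -[X in _ <= _ * X]exprMn.
  rewrite ler_pM ?sqr_ge0//.
    apply: le_trans (Ub _ _) _; rewrite lerXn2r ?nnegrE ?sqr_ge0//.
    by rewrite mulr_ge0 ?mulr_ge0// ltW.
  by rewrite lerXn2r ?nnegrE// (le_trans d1).
pose a := m%:R - 2 * b; have a0 : 0 < a by rewrite subr_gt0.
pose K := (4 * M) ^+ m * C ^+ 2 + 1.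
have K0 : 0 < K by rewrite ltr_wpDl// mulr_ge0 ?sqr_ge0// exprn_ge0// mulr_ge0.
(* Below distance e, [small] gives P^2 < P x0 y0 ^ 2, as the exponent a = m - 2 b is positive. *)
pose e := Num.min 1 ((P x0 y0 ^+ 2 / K) `^ a^-1).
have PK0 : 0 < P x0 y0 ^+ 2 / K by rewrite divr_gt0// exprn_gt0.
have e0 : 0 < e by rewrite lt_min ltr01 powR_gt0.
have near_diag x y : sphere x -> sphere y -> 1 - dotp x y < e -> P x y < P x0 y0.
  move=> xs ys he; have [xy|xy] := eqVneq x y.
    have := Ub (w y) (w y); rewrite subrr expr0n expr0n gtn_eqF// => U0.
    have /eqP : U (w y) (w y) ^+ 2 == 0 by rewrite eq_le U0 sqr_ge0.
    by move/eqP; rewrite sqrf_eq0 /P xy => /eqP ->; rewrite mul0r.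
  have [h0 h1] : 0 < 1 - dotp x y /\ 1 - dotp x y <= 1.
    by split; [exact: dotp_lt1|rewrite (le_trans (ltW he))// ge_min lexx].
  rewrite ltNge; apply/negP => P1.
  have : P x0 y0 ^+ 2 <= P x y ^+ 2 by rewrite lerXn2r ?nnegrE ?(ltW P0)// (le_trans (ltW P0)).
  apply/negP; rewrite -ltNge; apply: le_lt_trans (small _ _ xs ys xy h1) _.
  have : (1 - dotp x y) `^ a < P x0 y0 ^+ 2 / K.
    rewrite (_ : _ / K = ((P x0 y0 ^+ 2 / K) `^ a^-1) `^ a); last first.
      by rewrite -powRrM mulVf ?gt_eqF// powRr1 ?ltW.
    apply: gt0_ltr_powR => //; rewrite ?nnegrE ?powR_ge0 ?(ltW h0)//.
    by apply: lt_le_trans he _; rewrite ge_min lexx orbT.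
  rewrite ltr_pdivlMr// /K mulrDr mulr1 mulrC; apply: le_lt_trans.
  by rewrite -/a lerDl powR_ge0.
pose S := (@sphere R N `*` @sphere R N) `&` [set z | e <= 1 - dotp z.1 z.2].
have hc : continuous (fun z : 'rV[R]_N * 'rV[R]_N => 1 - dotp z.1 z.2).
  by move=> z; apply: cvgB; [exact: cvg_cst|exact: dotp_continuous].
have Sc : compact S.
  apply: compact_closedI; first by apply: compact_setX; exact: compact_sphere.
  apply: (@preimage_closed _ _ (fun z => 1 - dotp z.1 z.2) [set r | e <= r]).
    by move=> z _; exact: hc.
  exact: closed_ge.
have S0 : S (x0, y0).
  by split=> //=; rewrite leNgt; apply/negP => /(near_diag _ _ x0s y0s); rewrite ltxx.
have Pc : {within S, continuous (fun z : 'rV[R]_N * 'rV[R]_N =>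
    U (radial w z.2) (radial w z.1) * D (1 - dotp z.1 z.2))}.
  apply: continuous_in_subspaceT => -[x y]; rewrite inE => -[[/= xs ys] eh].
  have h0 : 0 < 1 - dotp x y by exact: lt_le_trans eh.
  have wc z : sphere z -> {for z, continuous (radial w)}.
    by move=> zs; exact: class_C_continuous wC (sphere_neq0 zs).
  apply: cvgM.
    apply: (@continuous2_cvg _ _ _ _ _ _ (fun z => radial w z.2)
      (fun z => radial w z.1) U (radial w y) (radial w x)).
    - exact: (Uc (_, _)).
    - apply: (@cvg_comp _ _ _ snd (radial w) _ (nbhs y)); first exact: cvg_snd.
      exact: wc.
    - apply: (@cvg_comp _ _ _ fst (radial w) _ (nbhs x)); first exact: cvg_fst.
      exact: wc.
  apply: (@cvg_comp _ _ _ (fun z => 1 - dotp z.1 z.2) D _ (nbhs (1 - dotp x y))).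
    exact: (hc (x, y)).
  exact: Dc.
have [[x y]] := compact_EVT_max (ex_intro _ _ S0) Sc Pc.
rewrite inE => -[[/= xs ys] eh] xymax.
have {}xymax x' y' : sphere x' -> sphere y' -> e <= 1 - dotp x' y' -> P x' y' <= P x y.
  move=> x's y's eh'; have := xymax (x', y').
  by rewrite /= !radial_sphere// inE; apply.
exists x, y; split=> //.
  apply: contraTneq (lt_le_trans e0 eh) => ->.
  by rewrite sphere_dotp// subrr ltxx.
move=> x' y' x's y's; have [|he] := leP e (1 - dotp x' y'); first exact: xymax.
by apply: ltW; apply: lt_le_trans (near_diag _ _ x's y's he) _; apply: xymax => //; case: S0.
Qed.

End PairMaximizerExistence.

(** * Comparison of Laplacians at a pair maximising a difference quotient *)

Section AdditiveComparison.
Variables (R : realType) (N : nat).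
Implicit Types (w : 'rV[R]_N -> R) (x y u v : 'rV[R]_N).

Lemma jet2_cst (t c : R) : jet2 t (fun=> c) 0 0.
Proof.
exists (fun=> 0); split => //; last exact: is_derive_cst.
by near=> s; exact: is_derive_cst.
Unshelve. all: end_near. Qed.

Lemma jet2_id (t : R) : jet2 t id 1 0.
Proof.
exists (fun=> 1); split => //; last exact: is_derive_cst.
by near=> s; exact: is_derive_id.
Unshelve. all: end_near. Qed.

Lemma jet2Z (c t : R) (u : R -> R) (a b : R) :
  jet2 t u a b -> jet2 t (fun s => c * u s) (c * a) (c * b).
Proof. by move=> j; apply: (jet2_eq (jet2M (jet2_cst t c) j)); ring. Qed.

Lemma jet2_powR (t a : R) : 0 < t ->
  jet2 t (fun s => s `^ a) (a * t `^ (a - 1)) (a * ((a - 1) * t `^ (a - 2))).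
Proof.
move=> t0; exists (fun s => a * s `^ (a - 1)); split => //.
  by near=> s; apply: is_derive1_powR; near: s; exact: lt_nbhsr.
have H : is_derive t 1 (fun s => s `^ (a - 1)) ((a - 1) * t `^ (a - 2)).
  have := is_derive1_powR (a - 1) t0.
  by rewrite (_ : a - 1 - 1 = a - 2)//; ring.
exact: (is_deriveZ a H).
Unshelve. all: end_near. Qed.

(* Maximises [(w y - w x) / h ^ ((1 - d) / 2)], [h] being half the squared chord:
   a maximal Lipschitz quotient, weakened by [d > 0] so that it is attained. *)
Lemma additive_comparison w (M k : R) x0 y0 (Q0 := w y0 - w x0) : (2 <= N)%N ->
  sphere_C 2 w ->
  (forall z, sphere z -> dotp (gradient (radial w) z) (gradient (radial w) z) <= M) ->
  k < N%:R - 1 -> sphere x0 -> sphere y0 -> w x0 < w y0 ->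
  exists x y, [/\ sphere x, sphere y & w x < w y] /\
   [/\ enorm (sphere_grad w x) ^+ 2 = enorm (sphere_grad w y) ^+ 2,
    Q0 / 2 <= w y - w x \/ (Q0 / 8) ^+ 2 <= enorm (sphere_grad w x) ^+ 2 &
    laplace_beltrami w y - laplace_beltrami w x < - (k * (w y - w x))].
Proof.
move=> N2 wC gM kn x0s y0s w0.
set n := N%:R - 1 in kn.
have n1 : 1 <= n by rewrite /n lerBrDr -(natrD _ 1 1) ler_nat.
have Q00 : 0 < Q0 by rewrite subr_gt0.
(* Then k <= n - 2 n d, hence k < n (1 - d). *)
pose d := Num.min (1 / 2) ((n - k) / (2 * n)).
have [d0 d1 d2] : [/\ 0 < d, d <= 1 / 2 & d * (2 * n) <= n - k].
  split; first by rewrite lt_min !divr_gt0//; lra.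
    by rewrite ge_min lexx.
  by rewrite -ler_pdivlMr ?ge_min ?lexx ?orbT//; lra.
pose a := (1 - d) / 2.
have [a0 a1] : 0 < a /\ 2 * a < 1 by rewrite /a; split; lra.
have xy0 : x0 != y0 by apply: contraTneq w0 => ->; rewrite ltxx.
have h00 := dotp_lt1 x0s y0s xy0.
have [|||||||||||x [y [xs ys xy xymax]]] := @pair_maximizer _ _ w (fun s t => s - t)
  (fun h => h `^ (- a)) M 1 a 1 x0 y0 _ gM.
- exact: (@class_C_S _ _ 1 _ _ wC).
- by move=> z; apply: cvgB; [exact: cvg_fst|exact: cvg_snd].
- by move=> s t; rewrite expr1.
- move=> h h0; apply: differentiable_continuous; apply/derivable1_diffP.
  exact: (@ex_derive _ _ _ _ _ _ _ (is_derive1_powR (- a) h0)).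
- by move=> h /andP[h0 _]; rewrite powR_ge0 mul1r lexx.
- exact: a1.
- by [].
- exact: x0s.
- exact: y0s.
- exact: xy0.
- by rewrite mulr_gt0 ?powR_gt0.
have h0 := dotp_lt1 xs ys xy; have /andP[_ h2] := dotp_sphere_bound xs ys.
have /andP[_ h02] := dotp_sphere_bound x0s y0s.
move: (xymax _ _ x0s y0s).
set h := 1 - dotp x y in h0 h2 xymax *; set h' := 1 - dotp x0 y0 in h00 h02 *.
set Q := w y - w x in xymax *; rewrite -/Q0 => QQ0.
have ha : h `^ (- a) = (h `^ a)^-1 by rewrite powRN.
have ha0 : 0 < h `^ a by rewrite powR_gt0.
have h'a : h' `^ (- a) = (h' `^ a)^-1 by rewrite powRN.
have h'a0 : 0 < h' `^ a by rewrite powR_gt0.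
have h'a2 : h' `^ a <= 2.
  apply: (@le_trans _ _ (2 `^ a)).
    by apply: ge0_ler_powR; rewrite ?nnegrE ?(ltW a0) ?(ltW h00).
  by rewrite -[leRHS]powRr1// ler_powR//; lra.
pose C := Q / h `^ a.
have CQ : Q = C * h `^ a by rewrite /C divfK// gt_eqF.
have C2 : Q0 / 2 <= C.
  apply: le_trans (_ : Q0 / h' `^ a <= C); last by rewrite /C -ha -h'a.
  by rewrite ler_pM2l// lef_pV2 ?posrE.
have C0 : 0 < C by lra.
have Q_gt0 : 0 < Q by rewrite CQ mulr_gt0.
have xs_max : pair_maximum w x y setT setT id (fun s => - s) (fun h => C * h `^ a).
  move=> x' y' x's y's _ _; rewrite -/h -CQ -/Q subrr.
  have [xy'|xy'] := eqVneq x' y'.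
    by rewrite xy' subrr sub0r oppr_le0 mulr_ge0 ?powR_ge0// ltW.
  have h'0 := dotp_lt1 x's y's xy'.
  have := xymax _ _ x's y's; rewrite ha -/C powRN.
  by rewrite ler_pdivrMr ?powR_gt0// subr_le0.
have [E1 E2 E3] := pair_maximum_principle wC xs ys xy filterT filterT xs_max
  (jet2_id _) (jet2N (jet2_id _)) (jet2Z C (jet2_powR a h0)).
have hn0 : h != 0 by rewrite gt_eqF.
have p1 : C * (a * h `^ (a - 1)) = a * Q / h.
  by rewrite powRD ?hn0 ?implybT// powR_inv1 ?(ltW h0)// CQ; ring.
have p2 : C * (a * ((a - 1) * h `^ (a - 2))) = a * (a - 1) * Q / h ^+ 2.
  rewrite (_ : a - 2 = a + (- 1 + - 1)); last ring.
  by rewrite !powRD ?hn0 ?implybT// powR_inv1 ?(ltW h0)// CQ -exprVn; ring.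
move: E1 E2 E3; rewrite p1 p2 mul1r mulN1r sqrrN -/h => E1 E2 E3.
exists x, y; split; first by split=> //; rewrite -subr_gt0.
split; first by rewrite E1 E2.
(* For h >= 1, Q >= C >= Q0 / 2. For h < 1, the squared gradient is at least (a C)^2, with a >=
   1/4. *)
- have [h1|h1] := leP 1 h; [left|right].
    rewrite -/Q CQ; apply: le_trans C2 _; rewrite ler_pMr//.
    by rewrite -[leLHS](powRr0 h) ler_powR// ltW.
  rewrite E2 CQ.
  have : h <= (h `^ a) ^+ 2.
    rewrite -powR_mulrn ?powR_ge0// -powRrM -[leLHS](powRr1 (ltW h0)) ger_powR ?h0 ?(ltW h1)//.
    by rewrite mulrC ltW.
  set P := h `^ a => hP.
  rewrite [leRHS](_ : _ = (a * C) ^+ 2 * (P ^+ 2 / h * (2 - h))); last by field.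
  have : 1 <= P ^+ 2 / h * (2 - h).
    have P1 : 1 <= P ^+ 2 / h by rewrite ler_pdivlMr// mul1r.
    by rewrite -[leLHS]mulr1 ler_pM//; lra.
  set Z := _ * (2 - h) => Z1.
  have : (Q0 / 8) ^+ 2 <= (a * C) ^+ 2.
    have a4 : 1 / 4 <= a by rewrite /a; lra.
    by rewrite lerXn2r ?nnegrE//; nra.
  move/le_trans; apply; by rewrite ler_peMr ?sqr_ge0.
- rewrite -/Q; apply: le_lt_trans (_ : - (n * (1 - d) * Q) < _); last first.
    by rewrite ltrN2 ltr_pM2r//; lra.
  have -> : laplace_beltrami w y - laplace_beltrami w x =
    1 * laplace_beltrami w y + 0 * enorm (sphere_grad w y) ^+ 2 +
       (-1 * laplace_beltrami w x + - 0 * enorm (sphere_grad w x) ^+ 2) by ring.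
  apply: le_trans E3 _; rewrite -/n.
  (* Since 2 a = 1 - d, the terms in (2 - h) / h combine with coefficient 2 a (2 a - 1) Q = - d (1 -
     d) Q, which has the favourable sign. *)
  rewrite (_ : _ + _ = - (n * (1 - d) * Q) - d * (1 - d) * Q * (2 - h) / h).
    rewrite gerBl divr_ge0 ?(ltW h0)// mulr_ge0//; last lra.
    by rewrite mulr_ge0 ?(ltW Q_gt0)// mulr_ge0 ?(ltW d0)//; lra.
  rewrite /a; field; exact: hn0.
Qed.

End AdditiveComparison.

(** * Secant bounds for the nonlinear term *)

Section Nonlinearity.
Variable R : realType.
Implicit Types p q g b r s t L M c : R.

(** Young's inequality for (1 + a (t - 1))^(1/a) and 1, then raised to the power a. *)
Lemma powR_bernoulli t a : 0 <= t -> 1 <= a -> 1 + a * (t - 1) <= t `^ a.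
Proof.
move=> t0 a1; have a0 : 0 < a by lra.
have [Y0|/ltW Y0] := leP (1 + a * (t - 1)) 0; first exact: le_trans (powR_ge0 _ _).
suff : (1 + a * (t - 1)) `^ a^-1 <= t.
  move=> /(ge0_ler_powR (ltW a0)); rewrite !nnegrE powR_ge0 => /(_ erefl t0).
  by rewrite -powRrM mulVf ?gt_eqF// powRr1.
move: a1; rewrite le_eqVlt => /predU1P[<-|a1].
  by rewrite invr1 powRr1 ?mul1r ?subrKC// addr_ge0//; move: Y0; lra.
have k1 : 0 < 1 - a^-1 by rewrite subr_gt0 invf_lt1.
have := @conjugate_powR R ((1 + a * (t - 1)) `^ a^-1) 1 a (1 - a^-1)^-1.
rewrite powR_ge0 ler01 a0 invr_gt0 k1 invrK subrKC => /(_ _ _ _ _ _).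
rewrite -powRrM mulVf ?gt_eqF// powRr1// powR1 mulr1 => /(_ _ _ _ _ _)/le_trans; apply => //.
by rewrite le_eqVlt; apply/orP; left; apply/eqP; field; rewrite gt_eqF.
Qed.

(* The nonlinear term of the equation is [r * slope p q g b r], with [r] the
   solution and [b] the square of the length of its gradient. *)
Definition slope p q g b r := `|r| `^ (p - 1) * (g ^+ 2 * r ^+ 2 + b) `^ (q / 2).

Lemma slope_ge0 p q g b r : 0 <= slope p q g b r.
Proof. by rewrite mulr_ge0 ?powR_ge0. Qed.

Lemma slopeN p q g b r : slope p q g b (- r) = slope p q g b r.
Proof. by rewrite /slope normrN sqrrN. Qed.

(** With h = t / s <= 1, the term at t is at least h^(p + q) times the term at s, because b >= h^2
    b; Bernoulli's inequality for h^(p + q) concludes. *)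
Lemma slope_secant_pos p q g b s t : 0 <= b -> 0 <= q -> 1 <= p + q -> 0 < t < s ->
  s * slope p q g b s - t * slope p q g b t <= (p + q) * slope p q g b s * (s - t).
Proof.
move=> b0 q0 pq /andP[t0 ts]; have s0 : 0 < s by exact: lt_trans ts.
pose h := t / s; have h0 : 0 < h by rewrite divr_gt0.
have h1 : h <= 1 by rewrite ler_pdivrMr// mul1r ltW.
have th : t = h * s by rewrite divfK// gt_eqF.
have H : h `^ (p + q) * (s * slope p q g b s) <= t * slope p q g b t.
  rewrite {1}/slope (gtr0_norm s0) (_ : p + q = 1 + (p - 1) + q); last ring.
  have hD r1 r2 : h `^ (r1 + r2) = h `^ r1 * h `^ r2.
    by rewrite powRD// (gt_eqF h0) implybT.
  rewrite hD [h `^ (1 + _)]hD powRr1 ?(ltW h0)//.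
  have -> : h * h `^ (p - 1) * h `^ q * (s * (s `^ (p - 1) * (g ^+ 2 * s ^+ 2 + b) `^ (q / 2)))
    = h * s * (h `^ (p - 1) * s `^ (p - 1)) * (h `^ q * (g ^+ 2 * s ^+ 2 + b) `^ (q / 2)).
    by ring.
  rewrite -powRM ?(ltW h0) ?(ltW s0)// -th /slope (gtr0_norm t0) -mulrA.
  rewrite ler_wpM2l ?(ltW t0)// ler_wpM2l ?powR_ge0//.
  have -> : h `^ q = (h ^+ 2) `^ (q / 2).
    by rewrite -powR_mulrn ?(ltW h0)// -powRrM; congr (_ `^ _); field.
  have gs : 0 <= g ^+ 2 * s ^+ 2 + b by rewrite addr_ge0// mulr_ge0// sqr_ge0.
  have gt : 0 <= g ^+ 2 * t ^+ 2 + b by rewrite addr_ge0// mulr_ge0// sqr_ge0.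
  rewrite -powRM ?sqr_ge0//; apply: ge0_ler_powR.
  - by rewrite divr_ge0.
  - by rewrite nnegrE mulr_ge0// sqr_ge0.
  - by rewrite nnegrE.
  have hh1 : h ^+ 2 <= 1 by rewrite expr_le1// ltW.
  have hb : h ^+ 2 * b <= b by rewrite ler_piMl.
  by rewrite th; lra.
have B := powR_bernoulli (ltW h0) pq.
have S0 : 0 <= s * slope p q g b s by rewrite mulr_ge0 ?slope_ge0// ltW.
apply: (@le_trans _ _ ((1 - h `^ (p + q)) * (s * slope p q g b s))); first lra.
rewrite (_ : _ * (s - t) = (p + q) * (1 - h) * (s * slope p q g b s)); last first.
  by rewrite th; ring.
by rewrite ler_wpM2r//; lra.
Qed.

Lemma slope_secant_opposite p q g b L s t : t <= 0 <= s ->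
  slope p q g b s <= L -> slope p q g b t <= L ->
  s * slope p q g b s - t * slope p q g b t <= L * (s - t).
Proof.
move=> /andP[t0 s0] sL tL.
have : s * slope p q g b s <= s * L by rewrite ler_wpM2l.
have : - t * slope p q g b t <= - t * L by rewrite ler_wpM2l// oppr_ge0.
lra.
Qed.

(** Cases on the signs of s and t: two negative values are reflected to positive ones, and for
    opposite signs the constant L already suffices since p + q >= 1. *)
Lemma slope_secant p q g b L s t : 0 <= b -> 0 <= q -> 1 <= p + q -> t < s ->
  slope p q g b s <= L -> slope p q g b t <= L ->
  s * slope p q g b s - t * slope p q g b t <= (p + q) * L * (s - t).
Proof.
move=> b0 q0 pq ts sL tL.
have [t0|t0] := ltP 0 t.
  apply: le_trans (slope_secant_pos g b0 q0 pq _) _; first by rewrite t0.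
  by rewrite ler_wpM2r ?subr_ge0 ?(ltW ts)// ler_wpM2l//; lra.
have [s0|s0] := ltP s 0.
  have := @slope_secant_pos p q g b (- t) (- s) b0 q0 pq.
  rewrite !slopeN oppr_gt0 ltrN2 s0 ts => /(_ isT) H.
  apply: le_trans (_ : _ <= (p + q) * slope p q g b t * (- t - - s)) _; first lra.
  rewrite (_ : - t - - s = s - t); last ring.
  by rewrite ler_wpM2r ?subr_ge0 ?(ltW ts)// ler_wpM2l//; lra.
apply: le_trans (slope_secant_opposite _ sL tL) _; first by rewrite t0.
rewrite ler_wpM2r ?subr_ge0 ?(ltW ts)// ler_peMl//.
exact: le_trans (slope_ge0 _ _ _ _ _) sL.
Qed.

(* For [q = 0] the hypothesis on [c_*] allows equality: the bound of
   [slope_secant] has to be improved by a fixed amount. *)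
Lemma power_slope_gap p M c : 1 < p -> 0 < c -> c < M ->
  exists2 L, L < M `^ (p - 1) & forall g b s t, 0 <= b -> t < s ->
    `|s| <= M -> `|t| <= M -> (c <= s - t \/ `|s| <= M - c /\ `|t| <= M - c) ->
    s * slope p 0 g b s - t * slope p 0 g b t <= p * L * (s - t).
Proof.
move=> p1 c0 cM; have M0 : 0 < M by lra.
have p0 : 0 < p by lra.
have p10 : 0 < p - 1 by lra.
have slE g b r : slope p 0 g b r = `|r| `^ (p - 1) by rewrite /slope mul0r powRr0 mulr1.
pose m := M `^ (p - 1); pose k := (M - c / 2) `^ (p - 1).
have m0 : 0 < m by rewrite powR_gt0.
have km : k < m by apply: gt0_ltr_powR; rewrite ?nnegrE//; lra.
have le_m r : `|r| <= M -> `|r| `^ (p - 1) <= m.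
  by move=> rM; apply: ge0_ler_powR; rewrite ?nnegrE//; lra.
have le_k r : `|r| <= M - c / 2 -> `|r| `^ (p - 1) <= k.
  by move=> rM; apply: ge0_ler_powR; rewrite ?nnegrE//; lra.
(* The first entry serves values of equal sign, where splitting [t, s] at its midpoint averages m
   and k, and values bounded by M - c. The second serves opposite signs, where the bound m (s - t)
   comes without the factor p. *)
pose L := Num.max ((m + k) / 2) (m / p).
have L1 : (m + k) / 2 <= L by rewrite le_max lexx.
have L2 : m <= p * L by rewrite mulrC -ler_pdivrMr// le_max lexx orbT.
exists L.
  rewrite gt_max -/m; apply/andP; split; first lra.
  by rewrite ltr_pdivrMr// ltr_pMr.
move=> g b s t b0 ts sM tM [cst|[sM' tM']]; last first.
  have := @slope_secant p 0 g b L s t b0 (lexx 0).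
  rewrite addr0 => /(_ (ltW p1) ts); apply; rewrite slE.
    by apply: le_trans L1; apply: le_trans (le_k _ _) _; lra.
  by apply: le_trans L1; apply: le_trans (le_k _ _) _; lra.
have pos s' t' : 0 < t' < s' -> s' <= M -> c <= s' - t' ->
    s' * slope p 0 g b s' - t' * slope p 0 g b t' <= p * L * (s' - t').
  move=> /andP[t'0 ts'] s'M c'.
  have := @slope_secant_pos p 0 g b s' ((s' + t') / 2) b0 (lexx 0).
  have := @slope_secant_pos p 0 g b ((s' + t') / 2) t' b0 (lexx 0).
  rewrite addr0 (ltW p1) => /(_ isT) + /(_ isT).
  have A1 : 0 < (s' + t') / 2 < s' by apply/andP; split; lra.
  have A2 : 0 < t' < (s' + t') / 2 by apply/andP; split; lra.
  move=> /(_ A2) H2 /(_ A1) H1.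
  have S1 : slope p 0 g b s' <= m by rewrite slE le_m// gtr0_norm//; lra.
  have S2 : slope p 0 g b ((s' + t') / 2) <= k by rewrite slE le_k// gtr0_norm//; lra.
  have T1 : p * slope p 0 g b s' * (s' - (s' + t') / 2) <= p * m * (s' - (s' + t') / 2).
    by rewrite ler_wpM2r ?ler_wpM2l ?(ltW p0)//; lra.
  have T2 : p * slope p 0 g b ((s' + t') / 2) * ((s' + t') / 2 - t') <=
      p * k * ((s' + t') / 2 - t').
    by rewrite ler_wpM2r ?ler_wpM2l ?(ltW p0)//; lra.
  have T3 : p * ((m + k) / 2) * (s' - t') <= p * L * (s' - t').
    by rewrite ler_wpM2r ?ler_wpM2l ?(ltW p0)//; lra.
  lra.
have [t0|t0] := ltP 0 t.
  by apply: pos => //; [rewrite t0|rewrite (le_trans (ler_norm _))].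
have [s0|s0] := ltP s 0.
  have := pos (- t) (- s); rewrite !slopeN oppr_gt0 ltrN2 s0 ts => /(_ isT).
  have -> : - t <= M by rewrite (le_trans _ tM)// -normrN ler_norm.
  have -> : - t - - s = s - t by ring.
  by move=> /(_ isT cst); lra.
have := @slope_secant_opposite p 0 g b m s t; rewrite t0 s0 !slE => /(_ isT).
move=> /(_ (le_m _ sM) (le_m _ tM))/le_trans; apply.
by rewrite ler_wpM2r// subr_ge0 ltW.
Qed.

End Nonlinearity.

(** * Comparison of Laplacians at a pair maximising a product *)

Section MultiplicativeComparison.
Variables (R : realType) (N : nat).
Implicit Types (w : 'rV[R]_N -> R) (x y u v : 'rV[R]_N).

Lemma jet2_ln (t : R) : 0 < t -> jet2 t (@ln R) t^-1 (- t ^- 2).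
Proof.
move=> t0; exists (fun s => s^-1); split => //.
  by near=> s; apply: is_derive1_ln; near: s; exact: lt_nbhsr.
have H := @is_deriveV _ (fun s : R => s) t _ _ (lt0r_neq0 t0) (is_derive_id t (1 : R)).
by apply: (is_derive_eq H); rewrite /GRing.scale/= mulr1.
Unshelve. all: end_near. Qed.

(** With n r = (2 - h) / h, the left-hand side is the second order bound for logarithms after the
    gradient terms have changed sides; the two sides differ by 8 b r / (r + 2)^2. *)
Lemma multiplicative_profile (n a b r : R) (u := nu a b r) : 1 <= n -> 0 <= r -> 0 <= b ->
  2 * u ^+ 2 * (n * r) + 4 * (n * r) * (- (a + b) + 2 * b * (2 * n - 1) / (n * (r + 2) ^+ 2))
   + 2 * u * (n * r - n)
  <= - (2 * n * (u * (1 - u) * r + u + 4 * b * r ^+ 2 / (r + 2) ^+ 2)).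
Proof.
move=> n1 r0 b0; have n0 : 0 < n by lra.
have r2 : 0 < r + 2 by lra.
rewrite -subr_ge0 (_ : _ - _ = 8 * b * r / (r + 2) ^+ 2).
  by rewrite divr_ge0 ?sqr_ge0// mulr_ge0// mulr_ge0.
by rewrite /u /nu; field; rewrite !gt_eqF.
Qed.

(** First and second derivatives of G h = (a + b) ln h - b' ln (2 + K h), with K = 2 n - 1 and b' =
    2 n b / K, expressed in r, where h = 2 / (1 + n r). *)
Lemma log_profile_derivatives (n a b r : R) (h := 2 / (1 + n * r)) : 1 <= n -> 0 <= r ->
  (a + b) / h - b * (2 * n) / (2 * n - 1) * ((2 + (2 * n - 1) * h)^-1 * (2 * n - 1)) =
    nu a b r / h /\
  (a + b) * - h ^- 2 - b * (2 * n) / (2 * n - 1) *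
      (- (2 + (2 * n - 1) * h) ^- 2 * (2 * n - 1) ^+ 2) =
    (- (a + b) + 2 * b * (2 * n - 1) / (n * (r + 2) ^+ 2)) / h ^+ 2.
Proof.
move=> n1 r0; have n0 : 0 < n by lra.
have nr : 0 <= n * r by rewrite mulr_ge0// ltW.
have -> : 2 + (2 * n - 1) * h = 2 * n * (r + 2) / (1 + n * r).
  by rewrite /h; field; rewrite gt_eqF//; lra.
by rewrite /h /nu; split; field; rewrite !gt_eqF//; lra.
Qed.

(* Maximises [- w x * w y / exp (G h)], where [h * G' h = nu a b (z ^ 2)] for
   [z ^ 2 = (2 - h) / (n h)]. *)
Lemma multiplicative_comparison w (M a b : R) x0 y0 (n : R := N%:R - 1) : (2 <= N)%N ->
  sphere_C 2 w ->
  (forall z, sphere z -> dotp (gradient (radial w) z) (gradient (radial w) z) <= M) ->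
  0 < a -> 0 <= b -> a + b < 1 -> sphere x0 -> sphere y0 -> w x0 < 0 < w y0 ->
  exists x y z (u := nu a b (z ^+ 2)), [/\ sphere x, sphere y, w x < 0 < w y & 0 <= z] /\
   [/\ enorm (sphere_grad w x) ^+ 2 = n * u ^+ 2 * z ^+ 2 * w x ^+ 2,
    enorm (sphere_grad w y) ^+ 2 = n * u ^+ 2 * z ^+ 2 * w y ^+ 2 &
    laplace_beltrami w y / w y + laplace_beltrami w x / w x <=
     - (2 * n * (u * (1 - u) * z ^+ 2 + u + 4 * b * (z ^+ 2) ^+ 2 / (z ^+ 2 + 2) ^+ 2))].
Proof.
move=> N2 wC gM a0 b0 ab1 x0s y0s /andP[w0 w1].
have n1 : 1 <= n by rewrite /n lerBrDr -(natrD _ 1 1) ler_nat.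
have xy0 : x0 != y0 by apply: contraTneq w0 => ->; rewrite -leNgt ltW.
have h00 := dotp_lt1 x0s y0s xy0.
pose K := 2 * n - 1; pose b' := b * (2 * n) / K.
have K0 : 0 < K by rewrite /K; lra.
have b'0 : 0 <= b' by rewrite divr_ge0 ?(ltW K0)// mulr_ge0//; lra.
have Kh (h : R) : 0 < h -> 0 < 2 + K * h by move=> h0; rewrite addr_gt0// mulr_gt0.
(* The positive parts make U continuous and zero unless w y > 0 > w x, which fixes the signs at a
   maximal pair; [D] is exp (- G). *)
pose U (s t : R) := Num.max s 0 * Num.max (- t) 0.
pose D (h : R) := h `^ (- (a + b)) * (2 + K * h) `^ b'.
have D0 h : 0 < h -> 0 < D h by move=> h0; rewrite mulr_gt0 ?powR_gt0 ?Kh.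
have [|||||||||||x [y [xs ys xy xymax]]] := @pair_maximizer _ _ w U D M
  ((2 + K * 2) `^ b') (a + b) 2 x0 y0 _ gM.
- exact: (@class_C_S _ _ 1 _ _ wC).
- move=> z; apply: cvgM.
    apply: (@continuous_max R _ fst (fun=> 0)); [exact: cvg_fst|exact: cvg_cst].
  apply: (@continuous_max R _ (fun z => - z.2) (fun=> 0)); last exact: cvg_cst.
  by apply: cvgN; exact: cvg_snd.
(* Both factors are at most |s - t|: this is the exponent m = 2, which tolerates a singularity of
   order a + b < 1. *)
- move=> s t; have U0 : 0 <= U s t by rewrite mulr_ge0// le_max lexx orbT.
  rewrite lerXn2r ?nnegrE ?sqr_ge0// {U0}/U.
  have [s0|s0] := leP s 0; first by rewrite mul0r sqr_ge0.
  have [t0|t0] := leP (- t) 0; first by rewrite mulr0 sqr_ge0.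
  nra.
- move=> h h0 C.
  have j := @jet2_comp _ h (fun s => s `^ b') (fun s => 2 + K * s) _ _ _ _
    (jet2_powR b' (Kh h h0)) (jet2D (jet2_cst h 2) (jet2Z K (jet2_id h))).
  exact: jet2_near (jet2M (jet2_powR (- (a + b)) h0) j).
- move=> h /andP[h0 h2]; rewrite (ltW (D0 _ h0))/= /D mulrC ler_wpM2r ?powR_ge0//.
  apply: ge0_ler_powR; rewrite ?nnegrE ?(ltW (Kh _ _))// lerD2l ler_wpM2l//.
  exact: ltW.
- by lra.
- by [].
- exact: x0s.
- exact: y0s.
- exact: xy0.
- rewrite mulr_gt0 ?D0// mulr_gt0// lt_max ?w1//.
  by rewrite oppr_gt0 w0.
have h0 := dotp_lt1 xs ys xy; have /andP[_ h2] := dotp_sphere_bound xs ys.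
have Umax : 0 < U (w y) (w x) * D (1 - dotp x y).
  apply: lt_le_trans (xymax _ _ x0s y0s).
  by rewrite mulr_gt0 ?D0// mulr_gt0// lt_max ?w1// oppr_gt0 w0.
have [wx wy] : w x < 0 /\ 0 < w y.
  move: Umax; rewrite pmulr_lgt0 ?D0// /U.
  have [s0|s0] := leP (w y) 0; first by rewrite mul0r ltxx.
  have [t0|t0] := leP (- w x) 0; first by rewrite mulr0 ltxx.
  by rewrite -oppr_gt0.
have UE s t : t < 0 -> 0 < s -> U s t = s * - t.
  by move=> t0 s0; rewrite /U !max_l// ?(ltW s0)// oppr_ge0 ltW.
pose G (h : R) := (a + b) * ln h - b' * ln (2 + K * h).
have lnD h : 0 < h -> ln (D h) = - G h.
  by move=> h0'; rewrite /D lnM ?posrE ?powR_gt0 ?Kh// !ln_powR /G; ring.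
have wmax : pair_maximum w x y [set s | 0 < s] [set s | s < 0]
    (@ln R) (fun s => ln (- s)) G.
  move=> x' y' x's y's /= wy' wx'.
  have xy' : x' != y' by apply: contraTneq wx' => ->; rewrite -leNgt ltW.
  have h'0 := dotp_lt1 x's y's xy'.
  rewrite -!lnD// -!lnM ?posrE ?oppr_gt0 ?mulr_gt0 ?oppr_gt0 ?powR_gt0 ?Kh//.
  rewrite ler_ln ?posrE ?mulr_gt0 ?oppr_gt0 ?powR_gt0 ?Kh//.
  by rewrite -!UE//; exact: xymax.
have jy := jet2_ln wy.
have wxN : 0 < - w x by rewrite oppr_gt0.
have jx := @jet2_comp _ _ (@ln R) (fun s => - s) _ _ _ _ (jet2_ln wxN) (jet2N (jet2_id (w x))).
move: h0 h2; set h := 1 - dotp x y => h0 h2.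
have jG := jet2D (jet2Z (a + b) (jet2_ln h0)) (jet2N (jet2Z b'
  (@jet2_comp _ h (@ln R) (fun s => 2 + K * s) _ _ _ _ (jet2_ln (Kh h h0))
    (jet2D (jet2_cst h 2) (jet2Z K (jet2_id h)))))).
have Ay : nbhs (w y) [set s | 0 < s] by exact: lt_nbhsr.
have Bx : nbhs (w x) [set s | s < 0] by exact: lt_nbhsl.
have [E1 E2 E3] := pair_maximum_principle wC xs ys xy Ay Bx wmax jy jx jG.
have n0 : 0 < n by lra.
pose r := (2 - h) / (h * n).
have r0 : 0 <= r by rewrite divr_ge0 ?subr_ge0// mulr_ge0 ?(ltW h0) ?(ltW n0).
have hr : h = 2 / (1 + n * r).
  by rewrite /r; field; rewrite !gt_eqF//; lra.
have [G1 G2] := log_profile_derivatives a b n1 r0.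
move: E1 E2 E3; rewrite -/h -/n !(mulr0, addr0, add0r, oppr0, mulr1).
rewrite /b' /K hr G1 G2 -hr.
set u := nu a b r; set H := - (a + b) + _ => E1 E2 E3.
have hh : (2 - h) / h = n * r by rewrite /r; field; rewrite !gt_eqF.
have hn0 : h != 0 by rewrite gt_eqF.
have wxn0 : w x != 0 by rewrite lt_eqF.
have wyn0 : w y != 0 by rewrite gt_eqF.
have F0 : (u / h) ^+ 2 * (h * (2 - h)) = n * u ^+ 2 * r.
  by rewrite -[n * _ * r]mulrAC -hh; field.
have F1 : enorm (sphere_grad w y) ^+ 2 = n * u ^+ 2 * r * w y ^+ 2.
  by rewrite -F0 -E1; field.
have F2 : enorm (sphere_grad w x) ^+ 2 = n * u ^+ 2 * r * w x ^+ 2.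
  by rewrite -F0 -E2; field.
have z2 : Num.sqrt r ^+ 2 = r by rewrite sqr_sqrtr.
exists x, y, (Num.sqrt r); rewrite /= z2 -/u.
split; first by rewrite wx wy sqrtr_ge0.
split=> //.
apply: (le_trans _ (multiplicative_profile a n1 r0 b0)); rewrite -/u.
have -> : laplace_beltrami w y / w y + laplace_beltrami w x / w x =
  (w y)^-1 * laplace_beltrami w y + - w y ^- 2 * enorm (sphere_grad w y) ^+ 2 +
  ((- w x)^-1 * -1 * laplace_beltrami w x +
   (- (- w x) ^- 2 * (-1) ^+ 2) * enorm (sphere_grad w x) ^+ 2) + 2 * (n * u ^+ 2 * r).
  by rewrite F1 F2; field; rewrite wxn0 wyn0.
rewrite -lerBrDr; apply: le_trans E3 _.
rewrite le_eqVlt; apply/orP; left; apply/eqP.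
have -> : 4 * (H / h ^+ 2) * (h * (2 - h)) = 4 * H * ((2 - h) / h) by field.
have -> : 2 * (u / h) * (2 - h - n * h) = 2 * u * ((2 - h) / h - n) by field.
by rewrite hh /H; ring.
Qed.

End MultiplicativeComparison.

(** * Rigidity under a slope bound, and exclusion of sign changes for p < 1 *)

Section Rigidity.
Variables (R : realType) (N : nat).
Implicit Types (w : 'rV[R]_N -> R) (x y u v : 'rV[R]_N) (gamma mu p q : R).

(** Moving from the maximiser along its own gradient g gives c |g|^2 = 0; c = 1 and c = -1 yield a
    maximum and a minimum of w. *)
Lemma critical_extremum w (c : R) : (0 < N)%N -> sphere_C 2 w -> c != 0 ->
  exists x, [/\ sphere x, forall z, sphere z -> c * w z <= c * w x
              & enorm (sphere_grad w x) = 0].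
Proof.
move=> N0 wC c0; have wC1 : sphere_C 1 w by exact: (@class_C_S _ _ 1 _ _ wC).
have S0 : @sphere R N !=set0.
  exists (unit_vec R (Ordinal N0)); apply: dotp_sphere.
  by rewrite dotp_unit_vec mxE !eqxx.
have Fc : {within @sphere R N, continuous (fun z => c * radial w z)}.
  apply: continuous_in_subspaceT => z; rewrite inE => zs.
  have wz : {for z, continuous (radial w)}.
    exact: class_C_continuous wC1 (sphere_neq0 zs).
  apply: continuousM => //; exact: cst_continuous.
have [x] := compact_EVT_max S0 (@compact_sphere R N) Fc.
rewrite inE => xs xmax; exists x.
have {}xmax z : sphere z -> c * w z <= c * w x.
  by move=> zs; have := xmax z; rewrite !radial_sphere// inE; apply.
split=> //.
set g := gradient (radial w) x.
have gx : dotp x g = 0 by rewrite dotpC dotp_gradient_radial ?sphere_neq0.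
have j := jet2Z c (class_C2_jet2 g (@open_neq0 R N) wC (sphere_neq0 xs)).
have [|/eqP + _] := jet2_max _ j.
  near=> t; rewrite scale0r addr0 [in leRHS]radial_sphere//.
  by apply: xmax; apply: sphere_normalize; exact: sphere_line_neq0.
rewrite mulf_eq0 (negPf c0) /= dotp_eq0 => /eqP g0.
rewrite sphere_grad_gradient// g0 /enorm.
by rewrite -(scale0r 0) dotpZl mul0r sqrtr0.
Unshelve. all: end_near. Qed.

Lemma solution_laplacian gamma mu p q w x : is_solution gamma mu p q w -> sphere x ->
  laplace_beltrami w x =
    w x * (mu - slope p q gamma (enorm (sphere_grad w x) ^+ 2) (w x)).
Proof. by move=> [_ /(_ x)] + xs => /(_ xs); rewrite /slope /energy; lra. Qed.

Lemma nonconstant_pair w : (0 < N)%N ->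
  ~ (exists c, forall x, sphere x -> w x = c) ->
  exists x y, [/\ sphere x, sphere y & w x < w y].
Proof.
move=> N0 wnc; pose e := unit_vec R (Ordinal N0).
have es : sphere e by apply: dotp_sphere; rewrite dotp_unit_vec mxE !eqxx.
apply: contrapT => H; apply: wnc; exists (w e) => x xs.
apply/eqP; rewrite eq_le !leNgt; apply/andP; split; apply/negP => ?; apply: H.
  by exists e, x.
by exists x, e.
Qed.

Lemma energy_gradient_bound gamma (c1 : R) w z : sphere_C 1 w -> sphere z ->
  energy gamma w z <= c1 ^+ 2 ->
  dotp (gradient (radial w) z) (gradient (radial w) z) <= c1 ^+ 2.
Proof.
move=> wC zs; rewrite /energy enorm_sqr sphere_grad_gradient//; apply: le_trans.
by rewrite lerDr mulr_ge0 ?sqr_ge0.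
Qed.

(** [additive_comparison] with the constant k - mu yields a pair at which the equation makes the
    nonlinear terms differ by more than k (w y - w x); a k < n + mu that bounds this difference is a
    contradiction. *)
Lemma slope_bound_rigidity gamma mu p q L c1 w : (2 <= N)%N -> 0 < gamma ->
  0 <= q -> 0 < p + q - 1 -> 0 < L -> 0 < c1 ->
  is_solution gamma mu p q w ->
  (forall x, sphere x -> energy gamma w x <= c1 ^+ 2) ->
  (forall x, sphere x -> slope p q gamma (enorm (sphere_grad w x) ^+ 2) (w x) <= L) ->
  L * (q * Num.sqrt (N%:R - 1) / (2 * gamma) + (p + q)) <= N%:R - 1 + mu ->
  (q = 0 -> (c1 / gamma) `^ (p - 1) <= L) ->
  exists c, forall x, sphere x -> w x = c.
Proof.
move=> N2 g0 q0 pq L0 c10 wS wE wL HL Lq.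
have wC := wS.1; have wC1 : sphere_C 1 w by exact: (@class_C_S _ _ 1 _ _ wC).
apply: contrapT => /(nonconstant_pair (ltnW N2))[x0 [y0 [x0s y0s wxy]]].
set n := N%:R - 1 in HL.
have n1 : 1 <= n by rewrite /n lerBrDr -(natrD _ 1 1) ler_nat.
have n0 : 0 < n by lra.
have gM z (zs : sphere z) := energy_gradient_bound wC1 zs (wE z zs).
pose Q0 := w y0 - w x0.
have Q00 : 0 < Q0 by rewrite subr_gt0.
suff [k kn Hk] : exists2 k, k < n + mu & forall x y, sphere x -> sphere y -> w x < w y ->
    enorm (sphere_grad w x) ^+ 2 = enorm (sphere_grad w y) ^+ 2 ->
    (Q0 / 2 <= w y - w x \/ (Q0 / 8) ^+ 2 <= enorm (sphere_grad w x) ^+ 2) ->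
    w y * slope p q gamma (enorm (sphere_grad w y) ^+ 2) (w y) -
    w x * slope p q gamma (enorm (sphere_grad w x) ^+ 2) (w x) <= k * (w y - w x).
  have kn' : k - mu < n by lra.
  have [x [y [[xs ys wlt] [Exy alt]]]] :=
    additive_comparison N2 wC gM kn' x0s y0s wxy.
  have := Hk x y xs ys wlt Exy alt; rewrite !(solution_laplacian wS)//.
  set sy := slope _ _ _ _ (w y); set sx := slope _ _ _ _ (w x).
  move: sy sx (w y) (w x) => sy sx t s H1 H2.
  lra.
(* For q > 0 the summand with the square root makes (p + q) L < n + mu strict; for q = 0 the
   strictness comes from [power_slope_gap]. *)
have [q_gt0|] := ltP 0 q.
  exists ((p + q) * L).
    apply: lt_le_trans HL; rewrite mulrC ltr_pM2l// ltrDr.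
    by rewrite divr_gt0 ?mulr_gt0 ?sqrtr_gt0.
  move=> x y xs ys wlt Exy _; rewrite Exy; apply: slope_secant => //.
  - by rewrite sqr_ge0.
  - lra.
  - exact: wL.
  - by rewrite -Exy; exact: wL.
rewrite le_eqVlt ltNge q0 orbF => /eqP q_eq0.
move: wL HL pq; rewrite q_eq0 mul0r mul0r add0r addr0 => wL HL pq.
pose M := c1 / gamma; have M0 : 0 < M by rewrite divr_gt0.
pose bt := (Q0 / (8 * gamma)) ^+ 2.
have bt0 : 0 < bt by rewrite exprn_gt0// divr_gt0// mulr_gt0.
(* c (2 M) <= bt turns w^2 <= M^2 - bt into |w| <= M - c, and c <= Q0 / 2 matches the other
   alternative. *)
pose c := Num.min (Q0 / 2) (Num.min (bt / (2 * M)) (M / 2)).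
have c0 : 0 < c by rewrite !lt_min !divr_gt0// mulr_gt0.
have cQ : c <= Q0 / 2 by rewrite ge_min lexx.
have cb : c * (2 * M) <= bt.
  have M2 : 0 < 2 * M by rewrite mulr_gt0.
  by rewrite -ler_pdivlMr// /c !ge_min lexx orbT.
have cM : c < M.
  by apply: le_lt_trans (_ : c <= M / 2) _; [by rewrite /c !ge_min lexx !orbT|lra].
have p1 : 1 < p by lra.
have [k kM Hk] := power_slope_gap p1 c0 cM.
exists (p * k).
  have : p * k < p * M `^ (p - 1) by rewrite ltr_pM2l//; lra.
  move/lt_le_trans; apply; apply: le_trans HL.
  by rewrite mulrC ler_wpM2r ?Lq//; lra.
move=> x y xs ys wlt Exy alt.
have absE z : sphere z -> w z ^+ 2 + enorm (sphere_grad w z) ^+ 2 / gamma ^+ 2 <= M ^+ 2.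
  move=> zs; have := wE z zs; rewrite /energy /M expr_div_n ler_pdivlMr ?exprn_gt0//.
  by rewrite mulrDl divfK ?expf_neq0 ?gt_eqF// mulrC.
have absM z : sphere z -> `|w z| <= M.
  move=> zs; rewrite -(@ler_pXn2r _ 2)// ?nnegrE ?(ltW M0)// real_normK ?num_real//.
  by apply: le_trans (absE z zs); rewrite lerDl divr_ge0 ?sqr_ge0.
rewrite Exy; apply: Hk; rewrite ?absM ?sqr_ge0//.
case: alt => [alt|alt]; [left; lra|right].
have gap z : sphere z -> (Q0 / 8) ^+ 2 <= enorm (sphere_grad w z) ^+ 2 ->
    `|w z| <= M - c.
  move=> zs gz; rewrite -(@ler_pXn2r _ 2)// ?nnegrE ?subr_ge0 ?(ltW cM)//.
  rewrite real_normK ?num_real//.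
  have : bt <= enorm (sphere_grad w z) ^+ 2 / gamma ^+ 2.
    rewrite ler_pdivlMr ?exprn_gt0//; apply: le_trans gz.
    by rewrite /bt -exprMn (_ : Q0 / (8 * gamma) * gamma = Q0 / 8)//; field; rewrite gt_eqF.
  have := absE z zs; have := sqr_ge0 c; lra.
by split; apply: gap => //; rewrite -Exy.
Qed.

(** Split q / 2 = (p + q - 1) / 2 + (1 - p) / 2 in the exponent of E: the first part is bounded
    through c1, and in the second the powers of |r| cancel. *)
Lemma slope_factor gamma p q (r Y c1 : R) (E := gamma ^+ 2 * r ^+ 2 * (1 + Y ^+ 2)) :
  0 < gamma -> r != 0 -> 0 <= p + q - 1 -> E <= c1 ^+ 2 -> 0 <= c1 ->
  `|r| `^ (p - 1) * E `^ (q / 2) <=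
    gamma `^ (1 - p) * c1 `^ (p + q - 1) * (1 + Y ^+ 2) `^ ((1 - p) / 2).
Proof.
move=> g0 r0 pq Ec c10; pose A := gamma * `|r|; pose B := 1 + Y ^+ 2.
have A0 : 0 < A by rewrite mulr_gt0 ?normr_gt0.
have B0 : 0 < B by rewrite ltr_pwDl ?sqr_ge0.
have EA : E = A ^+ 2 * B by rewrite /E exprMn real_normK ?num_real.
have E0 : 0 < E by rewrite EA mulr_gt0 ?exprn_gt0.
have powD (t a b : R) : 0 < t -> t `^ (a + b) = t `^ a * t `^ b.
  by move=> t0; rewrite powRD// (gt_eqF t0) implybT.
have sqrP (t a : R) : 0 <= t -> (t ^+ 2) `^ (a / 2) = t `^ a.
  by move=> t0; rewrite -powR_mulrn// -powRrM; congr (_ `^ _); field.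
have r1 : `|r| `^ (p - 1) = gamma `^ (1 - p) * A `^ (p - 1).
  rewrite powRM ?(ltW g0)// mulrA -powD//.
  by rewrite (_ : 1 - p + (p - 1) = 0) ?powRr0 ?mul1r//; ring.
rewrite r1 (_ : q / 2 = (p + q - 1) / 2 + (1 - p) / 2); last by field.
rewrite [E `^ _]powD// [X in _ * (_ * X `^ _)]EA powRM ?sqr_ge0 ?(ltW B0)// sqrP ?(ltW A0)//.
rewrite (_ : _ * _ = gamma `^ (1 - p) * E `^ ((p + q - 1) / 2) *
  (A `^ (p - 1) * A `^ (1 - p)) * B `^ ((1 - p) / 2)); last by ring.
rewrite -powD// (_ : p - 1 + (1 - p) = 0); last ring.
rewrite powRr0 mulr1 ler_wpM2r ?powR_ge0// ler_wpM2l ?powR_ge0//.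
rewrite -[leRHS]sqrP//; apply: ge0_ler_powR; rewrite ?nnegrE ?sqr_ge0 ?(ltW E0) ?divr_ge0//.
Qed.

Lemma sign_change_false gamma mu p q c1 w x0 y0 (L := gamma `^ (1 - p) * c1 `^ (p + q - 1)) :
  (2 <= N)%N -> 0 < gamma -> 0 <= mu -> 0 <= p -> p < 1 -> 0 < p + q - 1 -> 0 < c1 ->
  is_solution gamma mu p q w ->
  (forall x, sphere x -> energy gamma w x <= c1 ^+ 2) ->
  L * (q * Num.sqrt (N%:R - 1) / (2 * gamma) + (p + q)) <= N%:R - 1 + mu ->
  sphere x0 -> sphere y0 -> w x0 < 0 < w y0 -> False.
Proof.
move=> N2 g0 mu0 p0 p1 pq c10 wS wE HL x0s y0s wxy.
have wC := wS.1; have wC1 : sphere_C 1 w by exact: (@class_C_S _ _ 1 _ _ wC).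
set n := N%:R - 1 in HL.
have n1 : 1 <= n by rewrite /n lerBrDr -(natrD _ 1 1) ler_nat.
have n0 : 0 < n by lra.
have L0 : 0 < L by rewrite mulr_gt0 ?powR_gt0.
pose s := Num.sqrt n / gamma; pose k := 1 - p.
have sn : s ^+ 2 = n / gamma ^+ 2 by rewrite /s expr_div_n sqr_sqrtr ?(ltW n0).
have s0 : 0 < s by rewrite divr_gt0 ?sqrtr_gt0.
have [||||||[a b] /= [a0 b0 ab] Hz] := @supersolution_scaled R (L / n) (mu / n) k s.
- by rewrite divr_gt0.
- by rewrite divr_ge0 ?(ltW n0).
- by rewrite /k; lra.
- by rewrite /k; lra.
- exact: s0.
(* The inequality is strict because 1 < p + q, which also gives k = 1 - p < q. *)
- rewrite -(ltr_pM2r n0) [ltLHS](_ : _ = L * (1 + k * s / 2)).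
    2: by field; rewrite gt_eqF.
  rewrite [ltRHS](_ : _ = n + mu); last by field; rewrite gt_eqF.
  apply: lt_le_trans HL.
  rewrite ltr_pM2l// (_ : q * _ / _ = q * s / 2); last by rewrite /s; field; rewrite gt_eqF.
  have : 0 <= (q - k) * s by rewrite mulr_ge0 ?(ltW s0)// /k; lra.
  by rewrite /k; lra.
have [x [y [z [[xs ys /andP[wx wy] z0] [Gx Gy]]]]] :=
  multiplicative_comparison N2 wC
   (fun z zs => energy_gradient_bound wC1 zs (wE z zs)) a0 b0 ab x0s y0s wxy.
set u := nu a b (z ^+ 2) in Gx Gy *.
rewrite !(solution_laplacian wS)// Gx Gy.
(* At the pair the energy is gamma^2 w^2 (1 + (s u z)^2), so [slope_factor] applies with Y = s u
   z. *)
have slopeP t : sphere t -> w t != 0 ->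
    enorm (sphere_grad w t) ^+ 2 = n * u ^+ 2 * z ^+ 2 * w t ^+ 2 ->
    slope p q gamma (n * u ^+ 2 * z ^+ 2 * w t ^+ 2) (w t) <=
    L * (1 + (s * (u * z)) ^+ 2) `^ (k / 2).
  move=> ts wt Gt; have := wE t ts; rewrite /energy Gt /slope.
  have -> : gamma ^+ 2 * w t ^+ 2 + n * u ^+ 2 * z ^+ 2 * w t ^+ 2 =
      gamma ^+ 2 * w t ^+ 2 * (1 + (s * (u * z)) ^+ 2).
    have -> : (s * (u * z)) ^+ 2 = n / gamma ^+ 2 * (u ^+ 2 * z ^+ 2).
      by rewrite exprMn sn exprMn.
    by field; rewrite gt_eqF.
  by move=> Et; apply: slope_factor; rewrite ?(ltW pq) ?(ltW c10).
have := slopeP x xs (ltr0_neq0 wx) Gx; have := slopeP y ys (lt0r_neq0 wy) Gy.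
have := Hz z z0; rewrite -/u.
rewrite !(mulrC (w _)) !mulfK ?(ltr0_neq0 wx) ?(lt0r_neq0 wy)// -/n.
set P := _ `^ (k / 2); set T := u * (1 - u) * _ + _ + _.
move=> H1 H2 H3 H4.
have : L * P - mu < n * T.
  move: H1; rewrite -(ltr_pM2l n0) mulrBr [n * (mu / n)]mulrCA mulfV ?gt_eqF// mulr1.
  by rewrite mulrA [n * (L / n)]mulrCA mulfV ?gt_eqF// mulr1.
lra.
Qed.

End Rigidity.

(** * Powers of quotients and a pointwise bound on the slope *)

Section PowerBounds.
Variable R : realType.
Implicit Types p q s t c : R.

Lemma powR_div_exp s t p : 0 < s -> 0 < t -> (s / t) `^ (p - 1) = t `^ (1 - p) * s `^ (p - 1).
Proof.
move=> s0 t0; rewrite powRM ?invr_ge0 ?(ltW s0) ?(ltW t0)// mulrC.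
rewrite -(powR_inv1 (ltW t0)) -powRrM; congr (_ `^ _ * _); ring.
Qed.

Lemma powR_antitone s t p : p <= 1 -> 0 < s -> s <= t -> t `^ (p - 1) <= s `^ (p - 1).
Proof.
move=> p1 s0 st; have t0 : 0 < t by exact: lt_le_trans st.
rewrite (_ : p - 1 = - (1 - p)); last ring.
rewrite !powRN lef_pV2 ?posrE ?powR_gt0//.
by apply: ge0_ler_powR; rewrite ?nnegrE ?subr_ge0// ltW.
Qed.

Lemma slope_le p q g b r a c : 0 <= q -> 0 <= c -> 0 <= b -> g ^+ 2 * r ^+ 2 + b <= c ^+ 2 ->
  `|r| `^ (p - 1) <= a -> slope p q g b r <= a * c `^ q.
Proof.
move=> q0 c0 b0 Ec ra; rewrite /slope ler_pM ?powR_ge0//.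
have -> : c `^ q = (c ^+ 2) `^ (q / 2).
  by rewrite -powR_mulrn// -powRrM; congr (_ `^ _); field.
apply: ge0_ler_powR; rewrite ?nnegrE ?sqr_ge0 ?divr_ge0//.
by rewrite addr_ge0// mulr_ge0// sqr_ge0.
Qed.

End PowerBounds.

(** * Conclusion, by cases on p and on the sign of the solution *)

Theorem theoremF (R : realType) (N : nat) (gamma mu p q c1 c2 : R)
    (w : 'rV[R]_N -> R)
    (hN : (2 <= N)%N) (hgamma : 0 < gamma) (hmu : 0 < mu)
    (hp : 0 <= p) (hq0 : 0 <= q) (hq2 : q < 2) (hpq : 0 < p + q - 1)
    (hw : is_solution gamma mu p q w)
    (hc2 : 0 < c2) (hc12 : c2 < c1)
    (hbound : forall x : 'rV[R]_N, sphere x ->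
        c2 ^+ 2 <= energy gamma w x <= c1 ^+ 2)
    (hcstar : cstar c1 c2 p q <=
        2 * (N%:R - 1 + mu) * gamma `^ p /
          (q * Num.sqrt (N%:R - 1) + 2 * (p + q) * gamma)) :
  exists c : R, forall x : 'rV[R]_N, sphere x -> w x = c.
Proof.
have hc1 : 0 < c1 by exact: lt_trans hc12.
have wE x : sphere x -> energy gamma w x <= c1 ^+ 2 by move=> /hbound/andP[].
(* L is the bound on the slope for which the hypothesis on c_* takes the form [HL]. *)
pose n : R := N%:R - 1; pose L := gamma `^ (1 - p) * cstar c1 c2 p q.
have n1 : 1 <= n by rewrite /n lerBrDr -(natrD _ 1 1) ler_nat.
have cs0 : 0 < cstar c1 c2 p q.
  by rewrite /cstar; case: ifP => _; rewrite ?mulr_gt0 ?powR_gt0.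
have L0 : 0 < L by rewrite mulr_gt0 ?powR_gt0.
have HL : L * (q * Num.sqrt n / (2 * gamma) + (p + q)) <= n + mu.
  have D0 : 0 < q * Num.sqrt n + 2 * (p + q) * gamma.
    by rewrite ltr_wpDl ?mulr_ge0 ?sqrtr_ge0// !mulr_gt0//; lra.
  move: hcstar; rewrite -/n ler_pdivlMr// => H.
  have g1 : gamma `^ (1 - p) * gamma `^ p = gamma.
    rewrite -powRD ?subrK ?powRr1 ?(ltW hgamma)//.
    by rewrite (gt_eqF hgamma) implybT.
  have -> : L * (q * Num.sqrt n / (2 * gamma) + (p + q)) = gamma `^ (1 - p) *
      (cstar c1 c2 p q * (q * Num.sqrt n + 2 * (p + q) * gamma)) / (2 * gamma).
    by rewrite /L; field; rewrite gt_eqF.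
  rewrite ler_pdivrMr ?mulr_gt0//.
  apply: le_trans (ler_wpM2l (powR_ge0 _ _) H) _.
  rewrite mulrCA g1 le_eqVlt; apply/orP; left; apply/eqP; ring.
have wle x : sphere x -> gamma ^+ 2 * w x ^+ 2 + enorm (sphere_grad w x) ^+ 2 <= c1 ^+ 2.
  by move=> /wE.
have [p1|p1] := leP 1 p.
  have csE : L = (c1 / gamma) `^ (p - 1) * c1 `^ q.
    rewrite powR_div_exp// /L /cstar p1 -mulrA -powRD.
      by congr (_ * _ `^ _); ring.
    by rewrite (gt_eqF hc1) implybT.
  apply: (slope_bound_rigidity hN hgamma hq0 hpq L0 hc1 hw wE _ HL).
    move=> x xs; rewrite csE.
    apply: slope_le; rewrite ?(ltW hc1) ?sqr_ge0 ?wle//.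
    apply: ge0_ler_powR; rewrite ?nnegrE ?subr_ge0 ?divr_ge0 ?(ltW hc1) ?(ltW hgamma)//.
    rewrite ler_pdivlMr// -(@ler_pXn2r _ 2) ?nnegrE ?mulr_ge0 ?(ltW hgamma) ?(ltW hc1)//.
    rewrite exprMn real_normK ?num_real// mulrC; apply: le_trans (wle x xs).
    by rewrite lerDl sqr_ge0.
  by move=> q_eq0; rewrite csE q_eq0 powRr0 mulr1.
have csE : L = (c2 / gamma) `^ (p - 1) * c1 `^ q.
  by rewrite powR_div_exp// /L /cstar leNgt p1/= mulrA.
have no_zero : (forall x, sphere x -> c2 / gamma <= `|w x|) ->
    exists c : R, forall x : 'rV[R]_N, sphere x -> w x = c.
  move=> wge; apply: (slope_bound_rigidity hN hgamma hq0 hpq L0 hc1 hw wE _ HL).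
    move=> x xs; rewrite csE.
    apply: slope_le; rewrite ?(ltW hc1) ?sqr_ge0 ?wle//.
    by apply: powR_antitone; rewrite ?(ltW p1) ?divr_gt0 ?wge.
  (* q = 0 is impossible here, as p < 1 < p + q. *)
  by move=> q_eq0; exfalso; lra.
have big_at_critical x : sphere x -> enorm (sphere_grad w x) = 0 -> c2 / gamma <= `|w x|.
  move=> xs gx; have /andP[+ _] := hbound x xs.
  rewrite /energy gx expr0n addr0 ler_pdivrMr// => H.
  rewrite -(@ler_pXn2r _ 2) ?nnegrE ?mulr_ge0 ?(ltW hgamma) ?(ltW hc2)//.
  by rewrite exprMn real_normK ?num_real// mulrC.
have [[x0 [x0s wx0]]|npos] := pselect (exists x, sphere x /\ w x < 0); last first.
  apply: no_zero.
  have wge0 x : sphere x -> 0 <= w x.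
    by move=> xs; rewrite leNgt; apply/negP => wx; apply: npos; exists x.
  have N1 : (-1 : R) != 0 by rewrite oppr_eq0 oner_neq0.
  have [x [xs xmin gx]] := critical_extremum (ltnW hN) hw.1 N1.
  move=> z zs; apply: le_trans (big_at_critical x xs gx) _.
  by rewrite !ger0_norm ?wge0//; have := xmin z zs; rewrite !mulN1r lerN2.
have [[y0 [y0s wy0]]|nneg] := pselect (exists y, sphere y /\ 0 < w y); last first.
  apply: no_zero.
  have wle0 x : sphere x -> w x <= 0.
    by move=> xs; rewrite leNgt; apply/negP => wx; apply: nneg; exists x.
  have [x [xs xmax gx]] := critical_extremum (ltnW hN) hw.1 (oner_neq0 R).
  move=> z zs; apply: le_trans (big_at_critical x xs gx) _.
  by rewrite !ler0_norm ?wle0// lerN2; have := xmax z zs; rewrite !mul1r.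
exfalso.
apply: (sign_change_false hN hgamma (ltW hmu) hp p1 hpq hc1 hw wE _ x0s y0s); last first.
  by rewrite wx0 wy0.
(* For p < 1, c1^(p - 1) <= c2^(p - 1), so the constant of [sign_change_false], built from c1 alone,
   is at most L. *)
apply: le_trans HL; rewrite ler_wpM2r//.
  by rewrite addr_ge0 ?divr_ge0 ?mulr_ge0 ?sqrtr_ge0 ?(ltW hgamma)//; lra.
rewrite /L /cstar (leNgt 1 p) p1 /= ler_wpM2l ?powR_ge0//.
rewrite (_ : p + q - 1 = (p - 1) + q); last ring.
rewrite powRD ?(gt_eqF hc1) ?implybT// ler_wpM2r ?powR_ge0//.
by apply: powR_antitone; rewrite ?(ltW p1) ?(ltW hc12).
Qed.
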